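(* Let $V\in\mathcal{E}^2_+$ be of exponential order $N$ with $N^2<6$, and let $p_-=(y,z)=(-1,0)$. There exists a neighbourhood $\mathcal{N}(p_-)$ of $p_-$ in the $(y,z)$-plane such that for every $p\in\mathcal{N}(p_-)\cap\Omega_\epsilon$ the trajectory $\psi_p$ through $p$ approaches $p_-$ asymptotically in the past (as $\tau\to-\infty$), and, with the origin of the proper time $t$ chosen suitably for the solution (so that $\tau\to-\infty$ corresponds to $t\to0^+$), there is a constant $c>0$ (depending on the solution) such that as $t\to0^+$ $$K=t^{-1}+O(\epsilon_V(t)),\qquad \phi=-\sqrt{\tfrac23}\,\ln\frac tc+O(t\,\epsilon_V(t)),\qquad \dot\phi=-\sqrt{\tfrac23}\,t^{-1}+O(\epsilon_V(t)),$$ where $$\epsilon_V(t)=t\,V\!\left(-\sqrt{\tfrac23}\,\ln t\right).$$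
   Context: **Potentials.** A $C^2$ non-negative function $V:\mathbb{R}\to\mathbb{R}$ is called well behaved at infinity (WBI) of exponential order $N\in\mathbb{R}$ if there exists $\phi_0>0$ such that $V(\phi)>0$ for all $\phi>\phi_0$ and $W_V(\phi)=\frac{V'(\phi)}{V(\phi)}-N$ satisfies $\lim_{\phi\to\infty}W_V(\phi)=0$. For a map $z=f(\phi)$ taking $[\phi_0,\infty)$ onto $(0,f(\phi_0)]$ with $\lim_{\phi\to\infty}f(\phi)=0$, and a function $g$ of $\phi$, write $\overline g(z)=g(f^{-1}(z))$ for $z>0$ and $\overline g(0)=\lim_{\phi\to\infty}g(\phi)$. A $C^k$ potential $V$ is class $k$ WBI, written $V\in\mathcal{E}^k_+$, if it is WBI and there exist $\phi_0>0$ and $f$ mapping $[\phi_0,\infty)$ onto $(0,f(\phi_0)]$ with $\lim_{\phi\to\infty}f(\phi)=0$ such that: (i) $f$ is $C^{k+1}$ and strictly decreasing; (ii) $\overline{W_V}(z)$ and $\overline{f'}(z)$ are $C^k$ on the closed interval $[0,f(\phi_0)]$; (iii) $\frac{d\overline{W_V}}{dz}(0)=\frac{d\overline{f'}}{dz}(0)=0$. **Dynamical system.** The spatially flat FRW scalar field cosmologies with potential $V$ are the solutions, in proper time $t$, of $\frac{d\phi}{dt}=\dot\phi$, $\frac{d\dot\phi}{dt}=-K\dot\phi-V'(\phi)$, $\frac{dK}{dt}=-\frac32\dot\phi^2$ with $K^2=3V(\phi)+\frac32\dot\phi^2$ and $K>0$. Given $V\in\mathcal{E}^2_+$, fix $f$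 as in the definition (with $k=2$) and $\epsilon>0$ small enough that $\epsilon^{-1}\geq\phi_0$ and $V>0$ for $\phi\geq\epsilon^{-1}$. With $y=\sqrt{3/2}\,\dot\phi/K$, $z=f(\phi)$ and time $\tau$ defined by $\frac{d}{dt}=K\frac{d}{d\tau}$, the part of phase space with $\phi>\epsilon^{-1}$ is identified with $$\Omega_\epsilon=\{(y,z):0<z<f(\epsilon^{-1}),\ -1<y<1\},$$ on which the evolution is $$\frac{dy}{d\tau}=-\Big(y+\tfrac{1}{\sqrt6}\big(\overline{W_V}(z)+N\big)\Big)(1-y^2),\qquad \frac{dz}{d\tau}=\sqrt{\tfrac23}\,\overline{f'}(z)\,y,$$ a system that extends to a $C^2$ system on the closure of $\Omega_\epsilon$; $K$ is recovered from $y^2+3K^{-2}V(\phi)=1$. The trajectory $\psi_p$ is the solution of this system with $\psi_p(0)=p$. *)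

(* Defs.v *)
From Stdlib Require Import Reals.
From Coquelicot Require Import Coquelicot.
Open Scope R_scope.

(* Derivative relative to a set [D]: two-sided at interior points of [D],
   one-sided at the endpoints of an interval. *)
Definition is_derive_within (D : R -> Prop) (g : R -> R) (x l : R) : Prop :=
  filterlim (fun u => (g u - g x) / (u - x)) (within D (locally' x)) (locally l).

Definition derive_within (D : R -> Prop) (g : R -> R) (x : R) : R :=
  iota (fun l : R => is_derive_within D g x l).

Fixpoint Ck_on (k : nat) (D : R -> Prop) (g : R -> R) : Prop :=
  match k with
  | O => continuous_on D g
  | S k' => (forall x, D x -> exists l, is_derive_within D g x l) /\
            Ck_on k' D (derive_within D g)
  end.

Definition Ck (k : nat) (g : R -> R) : Prop :=
  forall x, (forall n, (n <= k)%nat -> ex_derive_n g n x) /\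
            continuous (Derive_n g k) x.

Definition W (V : R -> R) (N : R) (phi : R) : R := Derive V phi / V phi - N.

Record WBI (V : R -> R) (N : R) : Prop := {
  WBI_C2 : Ck 2 V;
  WBI_nonneg : forall phi, 0 <= V phi;
  WBI_infinity : exists phi0, 0 < phi0 /\ (forall phi, phi0 < phi -> 0 < V phi);
  WBI_lim : is_lim (W V N) p_infty 0 }.

Definition half_line (phi0 : R) (phi : R) : Prop := phi0 <= phi.
Definition segment (b : R) (z : R) : Prop := 0 <= z <= b.

(* The inverse of [f] restricted to [phi0, +oo). *)
Definition finv (phi0 : R) (f : R -> R) (z : R) : R :=
  iota (fun phi : R => phi0 <= phi /\ f phi = z).

(* [Lim] and [real] are total, but continuity of [bar phi0 f g] at 0 from the
   right forces [g] to have the finite limit [bar phi0 f g 0] at +oo. *)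
Definition bar (phi0 : R) (f g : R -> R) (z : R) : R :=
  if Req_EM_T z 0 then real (Lim g p_infty) else g (finv phi0 f z).

(* f', one-sided at [phi0]; the values of [f] below [phi0] play no role. *)
Definition fprime (phi0 : R) (f : R -> R) : R -> R :=
  derive_within (half_line phi0) f.

(* [W V N] is the total quotient V'/V - N.  Where V vanishes V'/V has no finite
   limit, so [coord_W] together with WBI entails V > 0 on [phi0, +oo). *)
Record WBI_coordinate (k : nat) (V : R -> R) (N phi0 : R) (f : R -> R) : Prop := {
  coord_phi0 : 0 < phi0;
  coord_onto : forall z, (0 < z <= f phi0) <-> (exists phi, phi0 <= phi /\ f phi = z);
  coord_lim : is_lim f p_infty 0;
  coord_Ck : Ck_on (S k) (half_line phi0) f;
  coord_decr : forall phi1 phi2, phi0 <= phi1 -> phi1 < phi2 -> f phi2 < f phi1;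
  coord_W : Ck_on k (segment (f phi0)) (bar phi0 f (W V N));
  coord_f' : Ck_on k (segment (f phi0)) (bar phi0 f (fprime phi0 f));
  coord_W0 : is_derive_within (segment (f phi0)) (bar phi0 f (W V N)) 0 0;
  coord_f'0 : is_derive_within (segment (f phi0)) (bar phi0 f (fprime phi0 f)) 0 0 }.

Definition class_WBI (k : nat) (V : R -> R) (N : R) : Prop :=
  WBI V N /\ Ck k V /\ exists phi0 f, WBI_coordinate k V N phi0 f.

Definition Omega (f : R -> R) (eps : R) (p : R * R) : Prop :=
  0 < snd p < f (/ eps) /\ -1 < fst p < 1.

Definition y_field (V : R -> R) (N phi0 : R) (f : R -> R) (p : R * R) : R :=
  - (fst p + / sqrt 6 * (bar phi0 f (W V N) (snd p) + N)) * (1 - fst p ^ 2).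

Definition z_field (phi0 : R) (f : R -> R) (p : R * R) : R :=
  sqrt (2 / 3) * bar phi0 f (fprime phi0 f) (snd p) * fst p.

Definition is_solution (V : R -> R) (N phi0 : R) (f : R -> R) (eps : R)
    (a b : Rbar) (psi : R -> R * R) : Prop :=
  forall tau : R, Rbar_lt a tau -> Rbar_lt tau b ->
    Omega f eps (psi tau) /\
    is_derive (fun s => fst (psi s)) tau (y_field V N phi0 f (psi tau)) /\
    is_derive (fun s => snd (psi s)) tau (z_field phi0 f (psi tau)).

(* [psi] on (a, b) is the inextensible solution in Omega with value [p] at 0. *)
Definition is_trajectory (V : R -> R) (N phi0 : R) (f : R -> R) (eps : R)
    (p : R * R) (a b : Rbar) (psi : R -> R * R) : Prop :=
  Rbar_lt a 0 /\ Rbar_lt 0 b /\ psi 0 = p /\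
  is_solution V N phi0 f eps a b psi /\
  (forall (a' b' : Rbar) (psi' : R -> R * R),
      Rbar_le a' a -> Rbar_le b b' ->
      is_solution V N phi0 f eps a' b' psi' ->
      (forall tau : R, Rbar_lt a tau -> Rbar_lt tau b -> psi' tau = psi tau) ->
      a' = a /\ b' = b).

Definition is_cosmology (V : R -> R) (t1 : R) (phi dphi K : R -> R) : Prop :=
  forall t, 0 < t < t1 ->
    is_derive phi t (dphi t) /\
    is_derive dphi t (- K t * dphi t - Derive V (phi t)) /\
    is_derive K t (- (3 / 2) * dphi t ^ 2) /\
    K t ^ 2 = 3 * V (phi t) + 3 / 2 * dphi t ^ 2 /\
    0 < K t.

(* The cosmology on (0, t1) is the trajectory [psi] on (a, b), read in proper
   time through tau = [sigma t]; the last clause is d/dt = K d/dtau. *)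
Definition proper_time_form (f : R -> R) (eps : R) (a b : Rbar) (psi : R -> R * R)
    (t1 : R) (phi dphi K sigma : R -> R) : Prop :=
  forall t, 0 < t < t1 ->
    Rbar_lt a (sigma t) /\ Rbar_lt (sigma t) b /\
    / eps < phi t /\
    psi (sigma t) = (sqrt (3 / 2) * dphi t / K t, f (phi t)) /\
    is_derive sigma t (K t).

Definition bigO (F : (R -> Prop) -> Prop) (g h : R -> R) : Prop :=
  exists C, F (fun t => Rabs (g t) <= C * Rabs (h t)).

Definition eps_V (V : R -> R) (t : R) : R := t * V (- sqrt (2 / 3) * ln t).

(* Main.v *)
(* In the coordinates (y, phi), phi = f^-1(z), the system reads phi' = k y with k = sqrt (2/3) and
   y' = -(y + (k/2) V'(phi)/V(phi)) (1 - y^2), with a C^1 right-hand side; the passage back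
   to z is legitimate because f' never vanishes.  Near p_- the bracket tends to
   -(1 - N/sqrt 6) < 0, so a corner {y < -1 + delta, phi > X} is invariant backwards and there
   w = 1 - y^2 satisfies w' >= lambda w.  A solution that ended at a finite past time would
   have a limit in Omega and could be continued, so it lives on (-oo, 0].

   Put q = 1/K; then q' = y^2 q and the constraint is w = 3 V(phi) q^2.  Proper time t has
   t' = q, so (t - q)' = w q <= (w q)'/lambda, which gives |t - q| <= w q / lambda without
   evaluating any integral.  In the same way (phi + k ln t)' = k (y + q/t) = O(w) = O(w'), so
   phi + k ln t has a limit k ln c with error O(w).  Finally w = O(t^2 V(phi)), and V(phi) is
   comparable to V(-k ln t) because V'/V is bounded and phi + k ln t is bounded. *)
Require Import Defs.
From Stdlib Require Import Reals Ranalysis5 Lra Lia ClassicalEpsilon.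
From Coquelicot Require Import Coquelicot.
Open Scope R_scope.

(** * Local existence for Lipschitz planar systems *)

(** A trajectory is only known to be inextensible, so a finite past endpoint is refuted by
    exhibiting a longer solution. This is why a local existence theorem and a gluing of solutions
    come before any asymptotics.

    The corner has [del] = min (1/2, lam/4). The 1/2 gives 2 |y| > 1, which turns the lower bound
    [lam] on the bracket into w' >= lam w. The lam/4 gives w <= lam/2, hence |t - q| <= q/2, so that
    t and 1/K are comparable on the whole past half-line.

    All errors are first measured by w, because w is controlled by its own derivative: a function g
    with |g'| <= C w' has a limit at -oo with error C w. The conversion to [eps_V] has to come last.
    It compares V(phi) with V(-k ln t), which requires phi + k ln t to be bounded; the crude bound w
    <= 1 in the error of its limit supplies this, and the sharp order of w follows. *)

Lemma is_derive_continuous (g : R -> R) (x l : R) : is_derive g x l -> continuous g x.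
Proof. intros H; apply (ex_derive_continuous (V := R_NormedModule)); now exists l. Qed.

Lemma continuous_eps (g : R -> R) (x : R) :
  continuous g x <->
  forall e, 0 < e -> exists d, 0 < d /\ forall u, Rabs (u - x) < d -> Rabs (g u - g x) < e.
Proof.
split.
- intros H e He.
  destruct (proj1 (filterlim_locally g (g x)) H (mkposreal e He)) as [d Hd].
  exists d; split; [apply cond_pos|]. intros u Hu. apply (Hd u Hu).
- intros H; apply filterlim_locally; intros e.
  destruct (H e (cond_pos e)) as [d [Hd Hu]].
  exists (mkposreal d Hd). intros u Hb. apply (Hu u Hb).
Qed.

(** Banach's fixed point theorem for the uniform distance on continuous functions on the whole line.
    Distances enter as explicit bounds; [D] makes the first displacement finite. *)
Lemma contraction_fixpoint (A : (R -> R) -> R -> R) (u0 : R -> R) (D : R) :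
  (forall t, continuous u0 t) ->
  (forall u, (forall t, continuous u t) -> forall t, continuous (A u) t) ->
  (forall u v d, (forall t, continuous u t) -> (forall t, continuous v t) ->
     (forall t, Rabs (u t - v t) <= d) -> forall t, Rabs (A u t - A v t) <= d / 2) ->
  (forall t, Rabs (A u0 t - u0 t) <= D) ->
  exists u, (forall t, continuous u t) /\ forall t, A u t = u t.
Proof.
intros C0 CA HA H0.
pose (U := fun n => Nat.iter n A u0).
assert (CU : forall n t, continuous (U n) t).
{ induction n as [|n IH]; [exact C0|]. apply CA, IH. }
assert (step : forall n t, Rabs (U (S n) t - U n t) <= D * (/ 2) ^ n).
{ induction n as [|n IH]; intros t.
  - simpl. rewrite Rmult_1_r. apply H0.
  - change (Rabs (A (U (S n)) t - A (U n) t) <= D * (/ 2) ^ S n).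
    replace (D * (/ 2) ^ S n) with (D * (/ 2) ^ n / 2) by (simpl; field).
    apply HA; auto. }
assert (D0 : 0 <= D) by (eapply Rle_trans; [apply Rabs_pos | apply (H0 0)]).
assert (P0 : forall n, 0 < (/ 2) ^ n) by (intros n; apply pow_lt; lra).
(* The tail of the geometric series, with the remainder still subtracted so that the induction on
   [p] closes. *)
assert (far : forall n p t, Rabs (U (n + p)%nat t - U n t) <= 2 * D * (/ 2) ^ n - 2 * D * (/ 2) ^ (n + p)).
{ intros n p t; induction p as [|p IH].
  - rewrite Nat.add_0_r. unfold Rminus. rewrite !Rplus_opp_r, Rabs_R0. lra.
  - rewrite Nat.add_succ_r. generalize (step (n + p)%nat t). simpl ((/ 2) ^ S (n + p)).
    replace (U (S (n + p)) t - U n t) with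
      ((U (S (n + p)) t - U (n + p)%nat t) + (U (n + p)%nat t - U n t)) by ring.
    intros Hs. eapply Rle_trans; [apply Rabs_triang|]. lra. }
assert (small : forall e, 0 < e -> exists n0, forall n, (n0 <= n)%nat -> 2 * D * (/ 2) ^ n < e).
{ intros e He.
  destruct (pow_lt_1_zero (/ 2)) with (y := e / (2 * D + 1)) as [n0 Hn0].
  - rewrite Rabs_pos_eq; lra.
  - apply Rdiv_lt_0_compat; lra.
  - exists n0; intros n Hn. specialize (Hn0 n Hn).
    rewrite Rabs_pos_eq in Hn0; [|left; apply P0].
    apply (Rmult_lt_compat_l (2 * D + 1)) in Hn0; [|lra].
    replace ((2 * D + 1) * (e / (2 * D + 1))) with e in Hn0 by (field; lra).
    generalize (P0 n); lra. }
assert (lim : forall t, exists l, forall n, Rabs (U n t - l) <= 2 * D * (/ 2) ^ n).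
{ intros t.
  assert (Hc : ex_finite_lim_seq (fun n => U n t)).
  { apply ex_lim_seq_cauchy_corr. intros e.
    destruct (small (e / 2)) as [n1 Hn1]; [generalize (cond_pos e); lra|].
    exists n1. intros n m Hn Hm.
    assert (Hx : forall j, (n1 <= j)%nat -> Rabs (U j t - U n1 t) < e / 2).
    { intros j Hj. replace j with (n1 + (j - n1))%nat by lia.
      eapply Rle_lt_trans; [apply far|].
      specialize (Hn1 n1 (Nat.le_refl _)).
      generalize (Rmult_le_pos (2 * D) _ ltac:(lra) (Rlt_le _ _ (P0 (n1 + (j - n1))%nat))); lra. }
    replace (U n t - U m t) with ((U n t - U n1 t) - (U m t - U n1 t)) by ring.
    generalize (Hx n Hn) (Hx m Hm). unfold Rabs; repeat destruct Rcase_abs; lra. }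
  destruct Hc as [l Hl]. exists l. intros n.
  assert (Hl' : is_lim_seq (fun p => Rabs (U (p + n)%nat t - U n t)) (Rabs (l - U n t))).
  { apply (is_lim_seq_abs _ (Finite (l - U n t))).
    apply is_lim_seq_minus'; [|apply is_lim_seq_const].
    apply (is_lim_seq_incr_n (fun n => U n t)), Hl. }
  rewrite Rabs_minus_sym.
  refine (is_lim_seq_le _ _ (Rabs (l - U n t)) (2 * D * (/ 2) ^ n) _ Hl' (is_lim_seq_const _)).
  intros p. rewrite Nat.add_comm. eapply Rle_trans; [apply far|].
  generalize (Rmult_le_pos (2 * D) _ ltac:(lra) (Rlt_le _ _ (P0 (n + p)%nat))); lra. }
pose (u := fun t => proj1_sig (constructive_indefinite_description _ (lim t))).
assert (Hu : forall n t, Rabs (U n t - u t) <= 2 * D * (/ 2) ^ n).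
{ intros n t. unfold u. now destruct constructive_indefinite_description. }
assert (Cu : forall t, continuous u t).
{ intros t. apply continuous_eps. intros e He.
  destruct (small (e / 3)) as [n Hn]; [lra|]. specialize (Hn n (Nat.le_refl _)).
  destruct (proj1 (continuous_eps _ _) (CU n t) (e / 3)) as [d [Hd Hdu]]; [lra|].
  exists d; split; [exact Hd|]. intros s Hs. specialize (Hdu s Hs).
  generalize (Hu n t) (Hu n s).
  revert Hdu. unfold Rabs; repeat destruct Rcase_abs; lra. }
exists u; split; [exact Cu|]. intros t.
apply Rminus_diag_uniq, Rabs_eq_0, Rle_antisym; [|apply Rabs_pos].
apply le_epsilon. intros e He.
destruct (small (e / 3)) as [n Hn]; [lra|]. specialize (Hn n (Nat.le_refl _)).
generalize (HA (U n) u _ (CU n) Cu (Hu n) t) (Hu (S n) t).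
change (U (S n) t) with (A (U n) t). simpl ((/ 2) ^ S n).
unfold Rabs; repeat destruct Rcase_abs; lra.
Qed.

(** The 1-Lipschitz retraction onto [lo, hi]. On time it lets the Picard operator act on functions
    on the whole line; on the phase variables it turns a locally Lipschitz field into a globally
    Lipschitz one. *)
Definition clamp (lo hi x : R) : R := Rmax lo (Rmin hi x).

Lemma clamp_bounds (lo hi x : R) : lo <= hi -> lo <= clamp lo hi x <= hi.
Proof. unfold clamp, Rmax, Rmin; repeat destruct Rle_dec; lra. Qed.

Lemma clamp_id (lo hi x : R) : lo <= x <= hi -> clamp lo hi x = x.
Proof. unfold clamp, Rmax, Rmin; repeat destruct Rle_dec; lra. Qed.

Lemma clamp_lipschitz (lo hi x y : R) :
  Rabs (clamp lo hi x - clamp lo hi y) <= Rabs (x - y).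
Proof.
unfold clamp, Rmax, Rmin, Rabs; repeat destruct Rle_dec; repeat destruct Rcase_abs; lra.
Qed.

Lemma is_derive_integral (g : R -> R) (a x : R) :
  (forall t, continuous g t) -> is_derive (RInt g a) x (g x).
Proof.
intros Cg. apply is_derive_RInt with a; [|apply Cg].
apply filter_forall. intros b. apply (RInt_correct (V := R_CompleteNormedModule)), (ex_RInt_continuous (V := R_CompleteNormedModule)). intros; apply Cg.
Qed.

Lemma integral_dist (g1 g2 : R -> R) (a b d : R) :
  (forall t, continuous g1 t) -> (forall t, continuous g2 t) ->
  (forall t, Rmin a b <= t <= Rmax a b -> Rabs (g1 t - g2 t) <= d) ->
  Rabs (RInt g1 a b - RInt g2 a b) <= Rabs (b - a) * d.
Proof.
intros C1 C2 H.
apply (norm_RInt_le_const_abs (V := R_NormedModule) (fun t => g1 t - g2 t) a b).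
- exact H.
- apply (is_RInt_minus (V := R_NormedModule)); apply (RInt_correct (V := R_CompleteNormedModule)), (ex_RInt_continuous (V := R_CompleteNormedModule)); auto.
Qed.

(** Because x' = k y, the second unknown is the integral [X] of the first, and the planar system
    becomes a fixed point equation for y alone. *)
Lemma picard (G : R -> R -> R) (L k y0 x0 : R) :
  0 <= L -> Rabs k <= 1 ->
  (forall y x y' x', Rabs (G y x - G y' x') <= L * (Rabs (y - y') + Rabs (x - x'))) ->
  exists h y x, 0 < h /\ y 0 = y0 /\ x 0 = x0 /\
    forall t, Rabs t < h ->
      is_derive y t (G (y t) (x t)) /\ is_derive x t (k * y t).
Proof.
intros HL Hk HG.
pose (X := fun (u : R -> R) s => x0 + k * RInt u 0 s).
assert (dX : forall u, (forall t, continuous u t) -> forall t, is_derive (X u) t (k * u t)).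
{ intros u Cu t. unfold X. auto_derive; [|ring].
  split; [apply (ex_RInt_continuous (V := R_CompleteNormedModule)); auto|]. split; [|easy].
  apply filter_forall; intros s; apply continuity_pt_filterlim, Cu. }
assert (CG : forall u, (forall t, continuous u t) -> forall t, continuous (fun s => G (u s) (X u s)) t).
{ intros u Cu t. apply continuous_eps. intros e He.
  destruct (proj1 (continuous_eps _ _) (Cu t) (e / (2 * L + 1))) as [d1 [Hd1 H1]].
  { apply Rdiv_lt_0_compat; lra. }
  destruct (proj1 (continuous_eps _ _) (is_derive_continuous _ _ _ (dX u Cu t)) (e / (2 * L + 1))) as [d2 [Hd2 H2]].
  { apply Rdiv_lt_0_compat; lra. }
  exists (Rmin d1 d2); split; [now apply Rmin_pos|]. intros s Hs.
  eapply Rle_lt_trans; [apply HG|].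
  specialize (H1 s (Rlt_le_trans _ _ _ Hs (Rmin_l _ _))).
  specialize (H2 s (Rlt_le_trans _ _ _ Hs (Rmin_r _ _))).
  assert (E : e = (2 * L + 1) * (e / (2 * L + 1))) by (field; lra).
  assert (0 < e / (2 * L + 1)) by (apply Rdiv_lt_0_compat; lra).
  apply Rle_lt_trans with (L * (2 * (e / (2 * L + 1)))); [|lra].
  apply Rmult_le_compat_l; lra. }
(* With h <= 1 and |k| <= 1, [X] does not increase distances on [-h, h], so the integrands differ by
   at most 2 L d. The factor 1/2 then asks for 4 h L <= 1. *)
pose (h := / (4 * L + 1)).
assert (Hh : 0 < h) by (apply Rinv_0_lt_compat; lra).
assert (Hh1 : h * (4 * L + 1) = 1) by (apply Rinv_l; lra).
assert (Hh2 : h <= 1) by nra.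
(* Time is frozen outside [-h, h], which makes the estimates uniform on the line; on (-h, h) the
   fixed point solves the genuine integral equation. *)
pose (A := fun u t => y0 + RInt (fun s => G (u s) (X u s)) 0 (clamp (- h) h t)).
assert (cl : forall t s, Rmin 0 (clamp (-h) h t) <= s <= Rmax 0 (clamp (-h) h t) -> Rabs s <= h).
{ intros t s. generalize (clamp_bounds (-h) h t ltac:(lra)).
  unfold Rmin, Rmax, Rabs; repeat destruct Rle_dec; destruct Rcase_abs; lra. }
destruct (contraction_fixpoint A (fun _ => y0) (h * (Rabs (G y0 x0) + L * Rabs y0))) as [y [Cy Hy]].
- intros t; apply continuous_const.
- intros u Cu t. unfold A. apply (continuous_plus (V := R_NormedModule)); [apply continuous_const|].
  apply (continuous_comp (clamp (-h) h) (RInt (fun s => G (u s) (X u s)) 0)).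
  + apply continuous_eps. intros e He. exists e; split; [exact He|]. intros s Hs.
    eapply Rle_lt_trans; [apply clamp_lipschitz|exact Hs].
  + eapply is_derive_continuous. apply is_derive_integral. now apply CG.
- intros u v d Cu Cv Huv t. unfold A.
  replace (_ - _) with (RInt (fun s => G (u s) (X u s)) 0 (clamp (-h) h t) - RInt (fun s => G (v s) (X v s)) 0 (clamp (-h) h t)) by ring.
  assert (Hd : 0 <= d) by (eapply Rle_trans; [apply Rabs_pos|apply (Huv 0)]).
  eapply Rle_trans.
  { apply (integral_dist _ _ _ _ (L * (d + d))); [now apply CG|now apply CG|].
    intros s Hs. apply cl in Hs. eapply Rle_trans; [apply HG|].
    apply Rmult_le_compat_l; [lra|]. apply Rplus_le_compat; [apply Huv|].
    unfold X. replace (_ - _) with (k * (RInt u 0 s - RInt v 0 s)) by ring.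
    rewrite Rabs_mult.
    generalize (integral_dist u v 0 s d Cu Cv (fun t _ => Huv t)). rewrite Rminus_0_r.
    intros Hi.
    assert (Rabs s * d <= 1 * d) by (apply Rmult_le_compat_r; lra).
    generalize (Rabs_pos k) (Rabs_pos (RInt u 0 s - RInt v 0 s)). nra. }
  rewrite Rminus_0_r.
  assert (Rabs (clamp (-h) h t) <= h).
  { apply (cl t). unfold Rmin, Rmax; destruct Rle_dec; lra. }
  apply Rle_trans with (h * (L * (d + d))); [apply Rmult_le_compat_r; nra|]. nra.
- intros t. unfold A.
  replace (y0 + _ - y0) with (RInt (fun s => G y0 (X (fun _ => y0) s)) 0 (clamp (-h) h t) - RInt (fun _ => 0) 0 (clamp (-h) h t)).
  2:{ rewrite RInt_const. change (scal (clamp (-h) h t - 0) 0) with ((clamp (-h) h t - 0) * 0). ring. }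
  assert (Rabs (clamp (-h) h t) <= h).
  { apply (cl t). unfold Rmin, Rmax; destruct Rle_dec; lra. }
  assert (0 <= L * Rabs y0) by (apply Rmult_le_pos; [lra|apply Rabs_pos]).
  eapply Rle_trans.
  { apply (integral_dist _ _ _ _ (Rabs (G y0 x0) + L * Rabs y0)).
    - apply CG. intros; apply continuous_const.
    - intros; apply continuous_const.
    - intros s Hs. apply cl in Hs. rewrite Rminus_0_r.
      replace (G y0 _) with (G y0 x0 + (G y0 (X (fun _ => y0) s) - G y0 x0)) by ring.
      eapply Rle_trans; [apply Rabs_triang|]. apply Rplus_le_compat_l.
      eapply Rle_trans; [apply HG|]. apply Rmult_le_compat_l; [lra|].
      replace (y0 - y0) with 0 by ring. rewrite Rabs_R0.
      unfold X. rewrite RInt_const. change (scal (s - 0) y0) with ((s - 0) * y0).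
      replace (_ - _) with (k * (s * y0)) by ring. rewrite !Rabs_mult.
      generalize (Rabs_pos k) (Rabs_pos s) (Rabs_pos y0). intros.
      assert (Rabs k * Rabs s <= 1) by nra. nra. }
  rewrite Rminus_0_r. apply Rmult_le_compat_r; [|assumption].
  generalize (Rabs_pos (G y0 x0)); lra.
- exists h, y, (X y). split; [exact Hh|]. split.
  { rewrite <- Hy. unfold A. rewrite clamp_id by lra. rewrite RInt_point. apply Rplus_0_r. }
  split.
  { unfold X. rewrite RInt_point. change zero with 0. ring. }
  intros t Ht. split; [|now apply dX].
  apply is_derive_ext_loc with (fun t => y0 + RInt (fun s => G (y s) (X y s)) 0 t).
  + apply Rabs_def2 in Ht.
    apply (locally_interval _ t (-h) h); simpl; try lra.
    intros s H1 H2. rewrite <- (Hy s). unfold A. rewrite clamp_id by lra. reflexivity.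
  + auto_derive; [|ring]. specialize (CG y Cy).
    split; [apply (ex_RInt_continuous (V := R_CompleteNormedModule)); auto|]. split; [|easy].
    apply filter_forall; intros s; apply continuity_pt_filterlim, CG.
Qed.

(** * One-variable calculus *)

Lemma nondecreasing_of_derive (g dg : R -> R) (a b : R) :
  a <= b -> (forall x, a <= x <= b -> is_derive g x (dg x)) ->
  (forall x, a < x < b -> 0 <= dg x) -> g a <= g b.
Proof.
intros [Hab| ->] Hd Hp; [|lra].
destruct (MVT_cor2 g dg a b Hab) as [c [E Hc]].
- intros c Hc. apply is_derive_Reals, Hd, Hc.
- specialize (Hp c Hc). assert (0 <= dg c * (b - a)) by (apply Rmult_le_pos; lra). lra.
Qed.

Lemma increasing_of_derive (g dg : R -> R) (a b : R) :
  a < b -> (forall x, a <= x <= b -> is_derive g x (dg x)) ->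
  (forall x, a < x < b -> 0 < dg x) -> g a < g b.
Proof.
intros Hab Hd Hp.
destruct (MVT_cor2 g dg a b Hab) as [c [E Hc]].
- intros c Hc. apply is_derive_Reals, Hd, Hc.
- specialize (Hp c Hc). assert (0 < dg c * (b - a)) by (apply Rmult_lt_0_compat; lra). lra.
Qed.

Lemma is_derive_eps (g : R -> R) (x l : R) :
  is_derive g x l <->
  forall e, 0 < e -> exists d, 0 < d /\
    forall u, Rabs (u - x) < d -> Rabs (g u - g x - l * (u - x)) <= e * Rabs (u - x).
Proof.
split.
- intros [_ H] e He.
  destruct (H x (fun P HP => HP) (mkposreal e He)) as [d Hd].
  exists d; split; [apply cond_pos|]. intros u Hu. specialize (Hd u Hu).
  rewrite (Rmult_comm l). exact Hd.
- intros H. split; [apply is_linear_scal_l|]. intros x' Hx' e.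
  rewrite <- (is_filter_lim_locally_unique x x' Hx').
  destruct (H e (cond_pos e)) as [d [Hd Hu]].
  exists (mkposreal d Hd). intros u Hb. specialize (Hu u Hb).
  rewrite (Rmult_comm l) in Hu. exact Hu.
Qed.

(** If x left a small interval around [x t0], monotonicity would carry z = F(x) beyond the value of
    F at an endpoint of that interval, against the continuity of z. *)
Lemma continuous_lift (F x z : R -> R) (D : R -> Prop) (t0 : R) :
  locally (x t0) D -> (forall a b, D a -> D b -> a < b -> F b < F a) ->
  locally t0 (fun t => D (x t) /\ F (x t) = z t) ->
  continuous z t0 -> continuous x t0.
Proof.
intros [r Hr] Hdec [s Hs] Hz. apply continuous_eps. intros e He.
pose (e' := Rmin e (r / 2)).
assert (He' : 0 < e') by (apply Rmin_pos; generalize (cond_pos r); lra).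
assert (e' <= e) by apply Rmin_l.
assert (e' <= r / 2) by apply Rmin_r.
assert (Hball : forall v, Rabs (v - x t0) <= e' -> D v).
{ intros v Hv. apply Hr. change (Rabs (v - x t0) < r). generalize (cond_pos r); lra. }
assert (D1 : D (x t0 + e')) by (apply Hball; rewrite Rabs_pos_eq; lra).
assert (D2 : D (x t0 - e')).
{ apply Hball. replace (_ - _) with (- e') by ring. rewrite Rabs_Ropp, Rabs_pos_eq; lra. }
destruct (Hs t0 (ball_center t0 s)) as [D0 E0].
assert (L1 : F (x t0 + e') < z t0) by (rewrite <- E0; apply Hdec; auto; lra).
assert (L2 : z t0 < F (x t0 - e')) by (rewrite <- E0; apply Hdec; auto; lra).
destruct (proj1 (continuous_eps z t0) Hz (Rmin (z t0 - F (x t0 + e')) (F (x t0 - e') - z t0)))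
  as [d [Hd Hdz]]; [apply Rmin_pos; lra|].
exists (Rmin d s); split; [apply Rmin_pos; [easy|apply cond_pos]|].
intros u Hu.
specialize (Hdz u (Rlt_le_trans _ _ _ Hu (Rmin_l _ _))).
destruct (Hs u (Rlt_le_trans _ _ _ Hu (Rmin_r _ _))) as [Du Eu].
generalize (Rlt_le_trans _ _ _ Hdz (Rmin_l _ _)) (Rlt_le_trans _ _ _ Hdz (Rmin_r _ _)).
rewrite <- Eu. intros A1 A2. apply Rabs_def2 in A1, A2.
apply Rabs_def1.
- apply Rnot_le_lt; intros Hc. destruct (Rle_lt_or_eq_dec (x t0 + e') (x u)) as [Hl|Hl]; [lra| |].
  + generalize (Hdec _ _ D1 Du Hl); lra.
  + rewrite <- Hl in A1, A2; lra.
- apply Rnot_le_lt; intros Hc. destruct (Rle_lt_or_eq_dec (x u) (x t0 - e')) as [Hl|Hl]; [lra| |].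
  + generalize (Hdec _ _ Du D2 Hl); lra.
  + rewrite Hl in A1, A2; lra.
Qed.

(** The inverse function theorem for a path x with F(x) = z. It serves twice: for phi in terms of z
    = f(phi), and for tau in terms of proper time. *)
Lemma is_derive_lift (F x z : R -> R) (D : R -> Prop) (t0 l m : R) :
  locally (x t0) D -> (forall a b, D a -> D b -> a < b -> F b < F a) ->
  locally t0 (fun t => D (x t) /\ F (x t) = z t) ->
  is_derive F (x t0) l -> l <> 0 -> is_derive z t0 m -> is_derive x t0 (m / l).
Proof.
intros HD Hdec Hloc HF Hl Hz.
assert (Cx : continuous x t0).
{ apply (continuous_lift F x z D); auto. now apply is_derive_continuous in Hz. }
apply is_derive_eps. intros e He.
assert (Al : 0 < Rabs l) by now apply Rabs_pos_lt.
(* A Lipschitz bound for x at [t0]: taking e1 <= |l|/2 absorbs the increment of x into the left side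
   of |l dx| <= e1 |dx| + (e1 + |m|) |dt|. Fed back, it bounds |l dx - m dt| by e1 (M + 1) |dt|,
   whence the last entry of [e1]. *)
pose (M := 2 * (Rabs m + 1) / Rabs l).
assert (HM : M * Rabs l = 2 * (Rabs m + 1)) by (unfold M; field; lra).
assert (HM0 : 0 <= M) by (generalize (Rabs_pos m); nra).
pose (e1 := Rmin (Rmin 1 (Rabs l / 2)) (e * Rabs l / (M + 1))).
assert (He1 : 0 < e1).
{ unfold e1. repeat apply Rmin_pos; try lra. apply Rdiv_lt_0_compat; [|lra].
  now apply Rmult_lt_0_compat. }
assert (e1 <= 1 /\ e1 <= Rabs l / 2) as [E1 E2].
{ split; (eapply Rle_trans; [apply Rmin_l|]); [apply Rmin_l|apply Rmin_r]. }
assert (E3 : e1 * (M + 1) <= e * Rabs l).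
{ replace (e * Rabs l) with (e * Rabs l / (M + 1) * (M + 1)) by (field; lra).
  apply Rmult_le_compat_r; [lra|apply Rmin_r]. }
destruct (proj1 (is_derive_eps _ _ _) HF e1 He1) as [d1 [Hd1 H1]].
destruct (proj1 (is_derive_eps _ _ _) Hz e1 He1) as [d2 [Hd2 H2]].
destruct (proj1 (continuous_eps _ _) Cx d1 Hd1) as [d3 [Hd3 H3]].
destruct Hloc as [s Hs].
exists (Rmin (Rmin d2 d3) s); split; [repeat apply Rmin_pos; auto; apply cond_pos|].
intros u Hu.
assert (U2 : Rabs (u - t0) < d2) by (eapply Rlt_le_trans; [exact Hu|]; eapply Rle_trans; [apply Rmin_l|apply Rmin_l]).
assert (U3 : Rabs (u - t0) < d3) by (eapply Rlt_le_trans; [exact Hu|]; eapply Rle_trans; [apply Rmin_l|apply Rmin_r]).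
destruct (Hs u (Rlt_le_trans _ _ _ Hu (Rmin_r _ _))) as [_ Eu].
destruct (Hs t0 (ball_center t0 s)) as [_ E0].
specialize (H1 _ (H3 u U3)). specialize (H2 u U2). rewrite Eu, E0 in H1.
set (dx := x u - x t0) in *. set (dt := u - t0) in *.
assert (K : Rabs (l * dx - m * dt) <= e1 * Rabs dx + e1 * Rabs dt).
{ replace (l * dx - m * dt) with ((z u - z t0 - m * dt) - (z u - z t0 - l * dx)) by ring.
  unfold Rminus at 1. eapply Rle_trans; [apply Rabs_triang|]. rewrite Rabs_Ropp. lra. }
assert (K2 : Rabs dx <= M * Rabs dt).
{ apply Rmult_le_reg_l with (Rabs l); [exact Al|].
  assert (Rabs l * Rabs dx <= Rabs (l * dx - m * dt) + Rabs m * Rabs dt).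
  { rewrite <- !Rabs_mult. replace (l * dx) with ((l * dx - m * dt) + m * dt) at 1 by ring.
    apply Rabs_triang. }
  generalize (Rabs_pos dx) (Rabs_pos dt); intros.
  replace (Rabs l * (M * Rabs dt)) with (M * Rabs l * Rabs dt) by ring. rewrite HM. nra. }
apply Rmult_le_reg_l with (Rabs l); [exact Al|].
rewrite <- Rabs_mult. replace (l * (dx - m / l * dt)) with (l * dx - m * dt) by (field; auto).
generalize (Rabs_pos dt); intros. nra.
Qed.

(** Needed at the seam of two glued solutions, where the equation is known on both sides only; by
    the mean value theorem the difference quotient is a value of [dg] nearby. *)
Lemma is_derive_extend (g dg : R -> R) (x r : R) :
  0 < r -> (forall u, 0 < Rabs (u - x) < r -> is_derive g u (dg u)) ->
  continuous g x -> continuous dg x -> is_derive g x (dg x).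
Proof.
intros Hr Hd Cg Cd. apply is_derive_eps. intros e He.
destruct (proj1 (continuous_eps _ _) Cd e He) as [d [Hd0 Hdd]].
exists (Rmin d r); split; [now apply Rmin_pos|]. intros u Hu.
assert (U1 := Rlt_le_trans _ _ _ Hu (Rmin_l _ _)).
assert (U2 := Rlt_le_trans _ _ _ Hu (Rmin_r _ _)).
assert (near : forall c, Rmin x u <= c <= Rmax x u -> Rabs (c - x) <= Rabs (u - x)).
{ intros c. unfold Rmin, Rmax, Rabs; destruct Rle_dec; repeat destruct Rcase_abs; lra. }
destruct (MVT_gen g x u dg) as [c [Hc E]].
- intros c Hc. apply Hd. split; [|eapply Rle_lt_trans; [apply near; lra|exact U2]].
  apply Rabs_pos_lt. revert Hc; unfold Rmin, Rmax; destruct Rle_dec; lra.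
- intros c Hc. apply continuity_pt_filterlim.
  destruct (Req_dec c x) as [->|Hn]; [exact Cg|].
  eapply is_derive_continuous. apply Hd. split; [apply Rabs_pos_lt; lra|].
  eapply Rle_lt_trans; [now apply near|exact U2].
- rewrite E. replace (_ - _) with ((dg c - dg x) * (u - x)) by ring.
  rewrite Rabs_mult. apply Rmult_le_compat_r; [apply Rabs_pos|].
  left. apply Hdd. eapply Rle_lt_trans; [now apply near|exact U1].
Qed.

(** Real induction from right to left: at the supremum of the failures [P] holds by closedness, and
    openness then contradicts the supremum. *)
Lemma backward_induction (P : R -> Prop) (s0 : R) :
  s0 <= 0 -> P 0 ->
  (forall s, s0 <= s <= 0 -> P s -> locally s P) ->
  (forall s, s0 <= s < 0 -> (forall r, s < r <= 0 -> P r) -> P s) ->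
  P s0.
Proof.
intros Hs0 P0 Hopen Hclosed. apply NNPP; intros Hn.
destruct (completeness (fun x => s0 <= x <= 0 /\ ~ P x)) as [m [Hub Hlub]].
- exists 0. intros x Hx; lra.
- exists s0; split; [lra|exact Hn].
- assert (M0 : s0 <= m) by (apply Hub; split; [lra|exact Hn]).
  assert (M1 : m <= 0) by (apply Hlub; intros x Hx; lra).
  assert (Pm : P m).
  { destruct M1 as [M1| ->]; [|exact P0]. apply Hclosed; [lra|]. intros r Hr.
    apply NNPP; intros Hc. assert (r <= m) by (apply Hub; split; [lra|exact Hc]). lra. }
  destruct (Hopen m (conj M0 M1) Pm) as [d Hd].
  assert (m <= m - d); [|generalize (cond_pos d); lra].
  apply Hlub. intros x [Hx Hnx]. apply Rnot_lt_le; intros Hc. apply Hnx, Hd.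
  change (Rabs (x - m) < d). assert (x <= m) by (apply Hub; split; auto).
  apply Rabs_def1; lra.
Qed.

(** The hypothesis says that the intervals [g - h, g + h] shrink as s decreases. The supremum of
    their left ends lies in all of them, so it is within [h s] of every [g s]. *)
Lemma limit_at_minus_infinity_dist (g h : R -> R) :
  (forall s, s <= 0 -> 0 <= h s) ->
  (forall s r, s <= r <= 0 -> Rabs (g r - g s) <= h r - h s) ->
  exists l, forall s, s <= 0 -> Rabs (g s - l) <= h s.
Proof.
intros Hh Hg.
assert (cross : forall s r, s <= 0 -> r <= 0 -> g s - h s <= g r + h r).
{ intros s r Hs Hr.
  assert (Hm : Rmin s r <= s /\ Rmin s r <= r) by (split; [apply Rmin_l|apply Rmin_r]).
  assert (H1 := Hg (Rmin s r) s ltac:(lra)). assert (H2 := Hg (Rmin s r) r ltac:(lra)).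
  assert (H3 := Hh (Rmin s r) ltac:(lra)).
  revert H1 H2; unfold Rabs; repeat destruct Rcase_abs; lra. }
destruct (completeness (fun x => exists s, s <= 0 /\ x = g s - h s)) as [l [Hub Hlub]].
- exists (g 0 + h 0). intros x [s [Hs ->]]. apply cross; lra.
- exists (g 0 - h 0), 0. split; [lra|easy].
- exists l. intros s Hs. apply Rabs_le.
  assert (g s - h s <= l) by (apply Hub; now exists s).
  assert (l <= g s + h s) by (apply Hlub; intros x [r [Hr ->]]; now apply cross).
  lra.
Qed.

(** Gronwall backwards in time: g exp(-lam x) is nondecreasing. The function g may be negative;
    applied to -(1 + y), the lemma bounds 1 + y from below. *)
Lemma exponential_decay (g dg : R -> R) (lam s : R) :
  s <= 0 -> (forall x, s <= x <= 0 -> is_derive g x (dg x)) ->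
  (forall x, s <= x <= 0 -> lam * g x <= dg x) -> g s <= g 0 * exp (lam * s).
Proof.
intros Hs Hd Hl.
assert (H := nondecreasing_of_derive (fun x => g x * exp (- lam * x))
  (fun x => (dg x - lam * g x) * exp (- lam * x)) s 0 Hs).
assert (E : exp (- lam * s) * exp (lam * s) = 1).
{ rewrite <- exp_plus. replace (_ + _) with 0 by ring. apply exp_0. }
assert (X : g s * exp (- lam * s) <= g 0).
{ replace (g 0) with (g 0 * exp (- lam * 0)) by (rewrite Rmult_0_r, exp_0; ring).
  apply H.
  - intros x Hx. specialize (Hd x Hx). auto_derive; [now exists (dg x)|].
    replace (Derive (fun x => g x) x) with (dg x) by (symmetry; apply is_derive_unique, Hd). ring.
  - intros x Hx. apply Rmult_le_pos; [|left; apply exp_pos].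
    specialize (Hl x ltac:(lra)); lra. }
replace (g s) with (g s * exp (- lam * s) * exp (lam * s)) by (rewrite Rmult_assoc, E; ring).
apply Rmult_le_compat_r; [left; apply exp_pos|exact X].
Qed.

(** * The coordinate f *)

Lemma is_derive_within_eps (D : R -> Prop) (g : R -> R) (x l : R) :
  is_derive_within D g x l ->
  forall e, 0 < e -> exists d, 0 < d /\
    forall u, D u -> Rabs (u - x) < d -> Rabs (g u - g x - l * (u - x)) <= e * Rabs (u - x).
Proof.
intros H e He.
destruct (proj1 (filterlim_locally _ l) H (mkposreal e He)) as [d Hd].
exists d; split; [apply cond_pos|]. intros u Du Hu.
destruct (Req_dec u x) as [->|Hn].
{ replace (_ - _) with 0 by ring. rewrite Rabs_R0. apply Rmult_le_pos; [lra|apply Rabs_pos]. }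
assert (Hb : Rabs ((g u - g x) / (u - x) - l) < e) by exact (Hd u Hu Hn Du).
replace (g u - g x - l * (u - x)) with (((g u - g x) / (u - x) - l) * (u - x)) by (field; lra).
rewrite Rabs_mult. apply Rmult_le_compat_r; [apply Rabs_pos|lra].
Qed.

Lemma is_derive_within_interior (D : R -> Prop) (g : R -> R) (x l : R) :
  locally x D -> is_derive_within D g x l -> is_derive g x l.
Proof.
intros [r Hr] H. apply is_derive_eps. intros e He.
destruct (is_derive_within_eps _ _ _ _ H e He) as [d [Hd Hu]].
exists (Rmin d r); split; [apply Rmin_pos; [easy|apply cond_pos]|].
intros u Hur. apply Hu.
- apply Hr. exact (Rlt_le_trans _ _ _ Hur (Rmin_r _ _)).
- exact (Rlt_le_trans _ _ _ Hur (Rmin_l _ _)).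
Qed.

Section Coordinate.

Variables (V : R -> R) (N phi0 : R) (f : R -> R).
Hypothesis hf : WBI_coordinate 2 V N phi0 f.

Lemma coord_inj (x y : R) : phi0 <= x -> phi0 <= y -> f x = f y -> x = y.
Proof.
intros Hx Hy E. destruct (Rtotal_order x y) as [L|[L|L]]; auto.
- generalize (coord_decr _ _ _ _ _ hf x y Hx L); lra.
- generalize (coord_decr _ _ _ _ _ hf y x Hy L); lra.
Qed.

Lemma coord_pos (x : R) : phi0 <= x -> 0 < f x <= f phi0.
Proof. intros Hx. apply (coord_onto _ _ _ _ _ hf). now exists x. Qed.

Lemma finv_coord (x : R) : phi0 <= x -> finv phi0 f (f x) = x.
Proof.
intros Hx. apply (iota_unique (V := R_CompleteNormedModule)).
- intros y [Hy E]. now apply coord_inj.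
- now split.
Qed.

Lemma bar_coord (g : R -> R) (x : R) : phi0 <= x -> bar phi0 f g (f x) = g x.
Proof.
intros Hx. unfold bar. destruct Req_EM_T as [E|_].
- generalize (coord_pos x Hx); lra.
- now rewrite finv_coord.
Qed.

(** Strictly to the right of [phi0] the half-line is a neighbourhood of x, so the derivative
    relative to it is two-sided and unique, and the [iota] of [derive_within] picks it. *)
Lemma is_derive_coord (x : R) : phi0 < x -> is_derive f x (fprime phi0 f x).
Proof.
intros Hx.
assert (HD : locally x (half_line phi0)).
{ apply (locally_interval _ x phi0 p_infty); simpl; auto. intros; unfold half_line; lra. }
destruct (proj1 (coord_Ck _ _ _ _ _ hf) x (Rlt_le _ _ Hx)) as [l Hl].
assert (Hd := is_derive_within_interior _ _ _ _ HD Hl).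
unfold fprime, derive_within. rewrite (iota_unique (V := R_CompleteNormedModule) _ l).
- exact Hd.
- intros y Hy. apply is_derive_within_interior in Hy; [|exact HD].
  rewrite <- (is_derive_unique _ _ _ Hd). symmetry. now apply is_derive_unique.
- exact Hl.
Qed.

(* [f] solves the autonomous equation f' = F(f) with F differentiable, so a zero of f' would
   make [f] locally constant. *)
Lemma coord_derive_neq_0 (x : R) : phi0 < x -> fprime phi0 f x <> 0.
Proof.
intros Hx H0.
destruct (proj1 (coord_f' _ _ _ _ _ hf) (f x)) as [l Hl].
{ unfold segment. generalize (coord_pos x (Rlt_le _ _ Hx)); lra. }
destruct (is_derive_within_eps _ _ _ _ Hl 1 Rlt_0_1) as [d [Hd Hu]].
rewrite (bar_coord _ x), H0 in Hu by lra.
(* Differentiability of f' as a function of z at the single point [f x], with error 1, gives |f'(u)|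
   <= L (f x - f u) just to the right of x. *)
pose (L := Rabs l + 1).
destruct (proj1 (continuous_eps f x) (is_derive_continuous _ _ _ (is_derive_coord x Hx)) d Hd)
  as [r [Hr Hfr]].
assert (bound : forall u, x <= u < x + r -> Rabs (fprime phi0 f u) <= L * (f x - f u)).
{ intros u Hux.
  assert (Hle : f u <= f x).
  { destruct (proj1 Hux) as [Lt| ->]; [|lra]. left. apply (coord_decr _ _ _ _ _ hf); lra. }
  assert (Hs : segment (f phi0) (f u)) by (unfold segment; generalize (coord_pos u ltac:(lra)); lra).
  specialize (Hu (f u) Hs). rewrite bar_coord, Rminus_0_r in Hu by lra.
  assert (Hz : Rabs (f u - f x) < d) by (apply Hfr, Rabs_def1; lra).
  specialize (Hu Hz). rewrite Rabs_minus_sym in Hz.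
  rewrite (Rabs_minus_sym (f u)), (Rabs_pos_eq (f x - f u)) in Hu by lra.
  replace (fprime phi0 f u) with ((fprime phi0 f u - l * (f u - f x)) + l * (f u - f x)) by ring.
  eapply Rle_trans; [apply Rabs_triang|].
  rewrite Rabs_mult, (Rabs_minus_sym (f u)), (Rabs_pos_eq (f x - f u)) by lra. unfold L; lra. }
(* By that bound (f u - f x) exp(-L u) is nondecreasing in u. It vanishes at x, yet strict decrease
   of f makes it negative at x + r/2. *)
assert (Hc : (f x - f x) * exp (- L * x) >= (f x - f (x + r / 2)) * exp (- L * (x + r / 2))).
{ assert (Hm := nondecreasing_of_derive (fun u => (f u - f x) * exp (- L * u))
    (fun u => (fprime phi0 f u - L * (f u - f x)) * exp (- L * u)) x (x + r / 2) ltac:(lra)).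
  cut ((f x - f x) * exp (- L * x) <= (f (x + r / 2) - f x) * exp (- L * (x + r / 2))); [lra|].
  apply Hm.
  - intros u Hux. assert (Hdu := is_derive_coord u ltac:(lra)).
    auto_derive; [now exists (fprime phi0 f u)|].
    replace (Derive (fun x => f x) u) with (fprime phi0 f u) by (symmetry; apply is_derive_unique, Hdu).
    ring.
  - intros u Hux. apply Rmult_le_pos; [|left; apply exp_pos].
    specialize (bound u ltac:(lra)). revert bound. unfold Rabs; destruct Rcase_abs; lra. }
assert (f (x + r / 2) < f x) by (apply (coord_decr _ _ _ _ _ hf); lra).
assert (0 < (f x - f (x + r / 2)) * exp (- L * (x + r / 2))).
{ apply Rmult_lt_0_compat; [lra|apply exp_pos]. }
lra.
Qed.

Lemma coord_onto_below (c z : R) : phi0 <= c -> 0 < z < f c ->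
  c < finv phi0 f z /\ f (finv phi0 f z) = z.
Proof.
intros Hc Hz.
destruct (proj1 (coord_onto _ _ _ _ _ hf z)) as [x [Hx E]].
{ generalize (coord_pos c Hc); lra. }
rewrite <- E, finv_coord by exact Hx. split; [|easy].
apply Rnot_le_lt; intros Hl. destruct Hl as [Hl| ->]; [|lra].
generalize (coord_decr _ _ _ _ _ hf x c Hx Hl); lra.
Qed.

End Coordinate.

(** * The system in the coordinates (y, phi) *)

Lemma locally_lipschitz_of_C1 (g dg : R -> R) (x0 : R) :
  locally x0 (fun x => is_derive g x (dg x)) -> continuous dg x0 ->
  exists r L, 0 < r /\ 0 <= L /\
    forall x y, Rabs (x - x0) <= r -> Rabs (y - x0) <= r -> Rabs (g x - g y) <= L * Rabs (x - y).
Proof.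
intros [d1 H1] C.
destruct (proj1 (continuous_eps _ _) C 1 Rlt_0_1) as [d2 [Hd2 H2]].
pose (r := Rmin d1 d2 / 2).
assert (0 < Rmin d1 d2) by (apply Rmin_pos; [apply cond_pos|easy]).
assert (R1 : r < d1) by (unfold r; generalize (Rmin_l d1 d2); lra).
assert (R2 : r < d2) by (unfold r; generalize (Rmin_r d1 d2); lra).
exists r, (Rabs (dg x0) + 1). split; [unfold r; lra|].
split; [generalize (Rabs_pos (dg x0)); lra|].
intros x y Hx Hy.
assert (near : forall c, Rmin y x <= c <= Rmax y x -> Rabs (c - x0) <= r).
{ intros c. revert Hx Hy. unfold Rmin, Rmax, Rabs; destruct Rle_dec; repeat destruct Rcase_abs; lra. }
assert (D : forall c, Rmin y x <= c <= Rmax y x -> is_derive g c (dg c)).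
{ intros c Hc. apply H1. change (Rabs (c - x0) < d1). generalize (near c Hc); lra. }
destruct (MVT_gen g y x dg) as [c [Hc E]].
- intros c Hc; apply D; lra.
- intros c Hc. apply continuity_pt_filterlim. eapply is_derive_continuous, D, Hc.
- rewrite E, Rabs_mult. apply Rmult_le_compat_r; [apply Rabs_pos|].
  specialize (H2 c ltac:(generalize (near c Hc); lra)).
  replace (dg c) with (dg x0 + (dg c - dg x0)) by ring.
  eapply Rle_trans; [apply Rabs_triang|]. lra.
Qed.

(** The right-hand side of the y-equation with W + N written as V'/V and 1/sqrt 6 as k/2, k = sqrt
    (2/3). *)
Definition y_rate (V : R -> R) (y x : R) : R :=
  - (y + sqrt (2 / 3) / 2 * (Derive V x / V x)) * (1 - y ^ 2).

Definition flow (V : R -> R) (c : R) (a b : Rbar) (y x : R -> R) : Prop :=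
  forall t : R, Rbar_lt a t -> Rbar_lt t b ->
    c < x t /\ -1 < y t < 1 /\
    is_derive y t (y_rate V (y t) (x t)) /\ is_derive x t (sqrt (2 / 3) * y t).

Lemma sqrt_2_3_pos : 0 < sqrt (2 / 3).
Proof. apply sqrt_lt_R0; lra. Qed.

Lemma sqrt_2_3_sqr : sqrt (2 / 3) * sqrt (2 / 3) = 2 / 3.
Proof. apply sqrt_sqrt; lra. Qed.

Lemma inv_sqrt_6 : / sqrt 6 = sqrt (2 / 3) / 2.
Proof.
assert (H : sqrt 6 * sqrt (2 / 3) = 2).
{ rewrite <- sqrt_mult by lra. replace (6 * (2 / 3)) with (2 * 2) by lra. apply sqrt_square; lra. }
assert (0 < sqrt 6) by (apply sqrt_lt_R0; lra).
apply Rmult_eq_reg_l with (sqrt 6); [|lra]. rewrite Rinv_r by lra. lra.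
Qed.

Section Coordinate.

Variables (V : R -> R) (N phi0 : R) (f : R -> R) (eps : R).
Hypothesis hf : WBI_coordinate 2 V N phi0 f.
Hypothesis heps : phi0 <= / eps.

(** The chain rule read backwards: z' = k f'(x) y with f'(x) different from 0 yields x' = k y. *)
Lemma flow_of_solution (a b : Rbar) (psi : R -> R * R) :
  is_solution V N phi0 f eps a b psi ->
  flow V (/ eps) a b (fun t => fst (psi t)) (fun t => finv phi0 f (snd (psi t))).
Proof.
intros H t Ha Hb.
assert (X : forall s : R, Rbar_lt a s -> Rbar_lt s b ->
  / eps < finv phi0 f (snd (psi s)) /\ f (finv phi0 f (snd (psi s))) = snd (psi s)).
{ intros s Hsa Hsb. destruct (H s Hsa Hsb) as [[Hz _] _].
  now apply (coord_onto_below V N phi0 f hf). }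
destruct (H t Ha Hb) as [[_ Hy] [Dy Dz]]. destruct (X t Ha Hb) as [Xc Xf].
split; [exact Xc|]. split; [exact Hy|]. split.
- unfold y_rate, y_field in *. rewrite <- Xf, (bar_coord V N phi0 f hf), inv_sqrt_6 in Dy by lra.
  unfold W in Dy. replace (Derive V (finv phi0 f (snd (psi t))) / V (finv phi0 f (snd (psi t))))
    with (Derive V (finv phi0 f (snd (psi t))) / V (finv phi0 f (snd (psi t))) - N + N) by ring.
  exact Dy.
- assert (F0 := coord_derive_neq_0 V N phi0 f hf (finv phi0 f (snd (psi t))) ltac:(lra)).
  replace (sqrt (2 / 3) * fst (psi t)) with
    (z_field phi0 f (psi t) / fprime phi0 f (finv phi0 f (snd (psi t)))).
  2:{ unfold z_field. rewrite <- Xf at 1. rewrite (bar_coord V N phi0 f hf) by lra. field. exact F0. }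
  apply (is_derive_lift f _ (fun s => snd (psi s)) (fun x => phi0 < x)).
  + apply (locally_interval _ _ phi0 p_infty); simpl; auto; lra.
  + intros; apply (coord_decr _ _ _ _ _ hf); lra.
  + apply (locally_interval _ t a b); auto. intros s Hsa Hsb.
    destruct (X s Hsa Hsb). split; [lra|easy].
  + apply (is_derive_coord V N phi0 f hf). lra.
  + exact F0.
  + exact Dz.
Qed.

Lemma solution_of_flow (a b : Rbar) (y x : R -> R) :
  flow V (/ eps) a b y x -> is_solution V N phi0 f eps a b (fun t => (y t, f (x t))).
Proof.
intros H t Ha Hb. destruct (H t Ha Hb) as [Xc [Hy [Dy Dx]]].
unfold Omega, y_field, z_field; simpl fst; simpl snd.
rewrite !(bar_coord V N phi0 f hf) by lra.
split; [split; [split|]|split].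
- apply (coord_pos V N phi0 f hf); lra.
- apply (coord_decr _ _ _ _ _ hf); lra.
- exact Hy.
- rewrite inv_sqrt_6. unfold W. replace (Derive V (x t) / V (x t) - N + N) with (Derive V (x t) / V (x t)) by ring.
  exact Dy.
- assert (Df := is_derive_coord V N phi0 f hf (x t) ltac:(lra)).
  replace (_ * _ * _) with (sqrt (2 / 3) * y t * fprime phi0 f (x t)) by ring.
  exact (is_derive_comp f x t _ _ Df Dx).
Qed.

End Coordinate.

(** * Regularity of the field, local existence and continuation to the left *)

Section Flow.

Variables (V : R -> R) (c : R).
Hypothesis V_C2 : Ck 2 V.
Hypothesis V_pos : forall x, c <= x -> 0 < V x.

Lemma is_derive_potential (x : R) : is_derive V x (Derive V x).
Proof. apply Derive_correct. exact (proj1 (V_C2 x) 1%nat ltac:(lia)). Qed.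

Lemma is_derive_log_derivative (x : R) : V x <> 0 ->
  is_derive (fun x => Derive V x / V x) x
    ((Derive (Derive V) x * V x - Derive V x * Derive V x) / V x ^ 2).
Proof.
intros H. apply is_derive_div; [|apply is_derive_potential|exact H].
apply Derive_correct. exact (proj1 (V_C2 x) 2%nat ltac:(lia)).
Qed.

Lemma continuous_potential (x : R) : continuous V x.
Proof. eapply is_derive_continuous, is_derive_potential. Qed.

Lemma continuous_derive_potential (x : R) : continuous (Derive V) x.
Proof.
apply (ex_derive_continuous (V := R_NormedModule)). exact (proj1 (V_C2 x) 2%nat ltac:(lia)).
Qed.

Lemma log_derivative_lipschitz (x0 : R) : c < x0 ->
  exists r L, 0 < r /\ 0 <= L /\
    forall x y, Rabs (x - x0) <= r -> Rabs (y - x0) <= r ->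
      Rabs (Derive V x / V x - Derive V y / V y) <= L * Rabs (x - y).
Proof.
intros Hx.
apply (locally_lipschitz_of_C1 (fun x => Derive V x / V x)
  (fun x => (Derive (Derive V) x * V x - Derive V x * Derive V x) / V x ^ 2) x0).
- apply (locally_interval _ x0 c p_infty); simpl; auto.
  intros x Hc _. apply is_derive_log_derivative. specialize (V_pos x ltac:(lra)); lra.
- assert (P := V_pos x0 ltac:(lra)).
  apply (continuous_mult (K := R_AbsRing)).
  + apply (continuous_minus (V := R_NormedModule)); apply (continuous_mult (K := R_AbsRing)).
    * exact (proj2 (V_C2 x0)).
    * apply continuous_potential.
    * apply continuous_derive_potential.
    * apply continuous_derive_potential.
  + apply (continuous_comp (fun x => V x ^ 2) Rinv).
    * apply (continuous_comp V (fun v => v ^ 2)); [apply continuous_potential|].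
      eapply is_derive_continuous. auto_derive; [easy|reflexivity].
    * apply continuous_Rinv. apply pow_nonzero. lra.
Qed.

Lemma continuous_y_rate (y x : R -> R) (t : R) :
  c < x t -> continuous y t -> continuous x t -> continuous (fun s => y_rate V (y s) (x s)) t.
Proof.
intros Hc Cy Cx. unfold y_rate.
apply (continuous_mult (K := R_AbsRing)).
- apply (continuous_opp (V := R_NormedModule)).
  apply (continuous_plus (V := R_NormedModule)); [exact Cy|].
  apply (continuous_mult (K := R_AbsRing)); [apply continuous_const|].
  apply (continuous_comp x (fun x => Derive V x / V x)); [exact Cx|].
  eapply is_derive_continuous, is_derive_log_derivative. specialize (V_pos (x t) ltac:(lra)); lra.
- apply (continuous_comp y (fun v => 1 - v ^ 2)); [exact Cy|].
  eapply is_derive_continuous. auto_derive; [easy|reflexivity].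
Qed.

(** The field is clamped to a box around the initial point, solved there, and the solution stays for
    a short time in the region where the clamps are the identity. *)
Lemma flow_local_existence (y0 x0 : R) : c < x0 -> -1 < y0 < 1 ->
  exists h y x, 0 < h /\ y 0 = y0 /\ x 0 = x0 /\ flow V c (- h) h y x.
Proof.
intros Hx0 Hy0.
destruct (log_derivative_lipschitz x0 Hx0) as [r0 [L [Hr0 [HL HLip]]]].
(* Half the distance to c keeps the box inside x > c. *)
pose (r := Rmin r0 ((x0 - c) / 2)).
assert (Hr : 0 < r) by (apply Rmin_pos; lra).
assert (r <= r0) by apply Rmin_l.
assert (r <= (x0 - c) / 2) by apply Rmin_r.
pose (cy := clamp (-1) 1). pose (cx := clamp (x0 - r) (x0 + r)).
pose (g := fun x => Derive V x / V x).
assert (By : forall y, -1 <= cy y <= 1) by (intros; apply clamp_bounds; lra).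
assert (Bx : forall x, Rabs (cx x - x0) <= r0).
{ intros x. generalize (clamp_bounds (x0 - r) (x0 + r) x ltac:(lra)). fold (cx x). intros.
  apply Rabs_le; lra. }
pose (B := Rabs (g x0) + L * r0).
assert (Bg : forall x, Rabs (g (cx x)) <= B).
{ intros x. replace (g (cx x)) with (g x0 + (g (cx x) - g x0)) by ring.
  eapply Rle_trans; [apply Rabs_triang|]. apply Rplus_le_compat_l.
  eapply Rle_trans; [apply HLip; [apply Bx|]|].
  - replace (x0 - x0) with 0 by ring. rewrite Rabs_R0; lra.
  - apply Rmult_le_compat_l; [lra|apply Bx]. }
assert (B0 : 0 <= B) by (eapply Rle_trans; [apply Rabs_pos|apply (Bg 0)]).
assert (Hk := sqrt_2_3_pos). assert (Hk2 := sqrt_2_3_sqr).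
assert (Hk1 : sqrt (2 / 3) <= 1) by nra.
pose (k := sqrt (2 / 3)). fold k in Hk, Hk1.
(* The bracket changes by at most dy + L dx against |1 - y^2| <= 1, and 1 - y^2 changes by at most 2
   dy against a bracket of size 1 + B. The sum is (3 + 2B) dy + L dx. *)
assert (Hmain : forall y x y' x', Rabs (y_rate V (cy y) (cx x) - y_rate V (cy y') (cx x')) <=
   (3 + 2 * B + L) * (Rabs (y - y') + Rabs (x - x'))).
{ intros y x y' x'. unfold y_rate. fold k. fold (g (cx x)) (g (cx x')).
  replace (_ - _) with
    (- ((cy y - cy y') + k / 2 * (g (cx x) - g (cx x'))) * (1 - cy y ^ 2)
     + (cy y' + k / 2 * g (cx x')) * ((cy y - cy y') * (cy y + cy y'))) by ring.
  assert (E1 : Rabs (cy y - cy y') <= Rabs (y - y')) by apply clamp_lipschitz.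
  assert (E2 : Rabs (g (cx x) - g (cx x')) <= L * Rabs (x - x')).
  { eapply Rle_trans; [apply HLip; apply Bx|]. apply Rmult_le_compat_l; [lra|apply clamp_lipschitz]. }
  assert (E3 := Bg x'). assert (Y := By y). assert (Y' := By y').
  set (dy := Rabs (y - y')) in *. set (dx := Rabs (x - x')) in *.
  assert (0 <= dy) by apply Rabs_pos. assert (0 <= dx) by apply Rabs_pos.
  eapply Rle_trans; [apply Rabs_triang|]. rewrite !Rabs_mult, Rabs_Ropp.
  assert (F1 : Rabs (cy y - cy y' + k / 2 * (g (cx x) - g (cx x'))) <= dy + L * dx).
  { eapply Rle_trans; [apply Rabs_triang|]. rewrite Rabs_mult, (Rabs_pos_eq (k / 2)) by lra.
    generalize (Rabs_pos (g (cx x) - g (cx x'))). nra. }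
  assert (F2 : Rabs (1 - cy y ^ 2) <= 1) by (apply Rabs_le; nra).
  assert (F3 : Rabs (cy y' + k / 2 * g (cx x')) <= 1 + B).
  { eapply Rle_trans; [apply Rabs_triang|]. rewrite Rabs_mult, (Rabs_pos_eq (k / 2)) by lra.
    apply Rplus_le_compat; [apply Rabs_le; lra|]. generalize (Rabs_pos (g (cx x'))). nra. }
  assert (F4 : Rabs (cy y + cy y') <= 2) by (apply Rabs_le; lra).
  assert (G1 : Rabs (cy y - cy y' + k / 2 * (g (cx x) - g (cx x'))) * Rabs (1 - cy y ^ 2) <= (dy + L * dx) * 1)
    by (apply Rmult_le_compat; auto using Rabs_pos).
  assert (G2 : Rabs (cy y - cy y') * Rabs (cy y + cy y') <= dy * 2)
    by (apply Rmult_le_compat; auto using Rabs_pos).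
  assert (G3 : Rabs (cy y' + k / 2 * g (cx x')) * (Rabs (cy y - cy y') * Rabs (cy y + cy y')) <= (1 + B) * (dy * 2)).
  { apply Rmult_le_compat; auto using Rabs_pos. apply Rmult_le_pos; apply Rabs_pos. }
  assert (0 <= L * dy) by (apply Rmult_le_pos; lra).
  assert (0 <= B * dx) by (apply Rmult_le_pos; lra).
  lra. }
destruct (picard (fun y x => y_rate V (cy y) (cx x)) (3 + 2 * B + L) k y0 x0) as [h1 [y [x [Hh1 [Ey [Ex D]]]]]].
- lra.
- rewrite Rabs_pos_eq; lra.
- exact Hmain.
- destruct (D 0) as [Dy0 Dx0]; [now rewrite Rabs_R0|].
  destruct (proj1 (continuous_eps _ _) (is_derive_continuous _ _ _ Dy0) (Rmin (1 - y0) (y0 + 1)))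
    as [d1 [Hd1 H1]]; [apply Rmin_pos; lra|].
  destruct (proj1 (continuous_eps _ _) (is_derive_continuous _ _ _ Dx0) r Hr) as [d2 [Hd2 H2]].
  rewrite Ey in H1. rewrite Ex in H2.
  exists (Rmin h1 (Rmin d1 d2)), y, x. split; [repeat apply Rmin_pos; auto|].
  split; [exact Ey|]. split; [exact Ex|]. intros t Ha Hb; simpl in Ha, Hb.
  assert (Ht : Rabs t < Rmin h1 (Rmin d1 d2)) by (apply Rabs_def1; lra).
  assert (T1 := Rlt_le_trans _ _ _ Ht (Rmin_l _ _)).
  assert (T2 := Rlt_le_trans _ _ _ Ht (Rmin_r _ _)).
  assert (T3 := Rlt_le_trans _ _ _ T2 (Rmin_l _ _)).
  assert (T4 := Rlt_le_trans _ _ _ T2 (Rmin_r _ _)).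
  specialize (H1 t ltac:(rewrite Rminus_0_r; auto)).
  specialize (H2 t ltac:(rewrite Rminus_0_r; auto)).
  assert (U1 := Rlt_le_trans _ _ _ H1 (Rmin_l _ _)).
  assert (U2 := Rlt_le_trans _ _ _ H1 (Rmin_r _ _)).
  apply Rabs_def2 in U1, U2, H2.
  destruct (D t T1) as [Dy Dx].
  unfold cy, cx in Dy. rewrite !clamp_id in Dy by lra.
  split; [lra|]. split; [lra|]. split; [exact Dy|exact Dx].
Qed.

Lemma flow_extend (a : R) (b : Rbar) (y x : R -> R) (ya xa : R) :
  Rbar_lt a b -> flow V c a b y x ->
  filterlim y (at_right a) (locally ya) -> filterlim x (at_right a) (locally xa) ->
  -1 < ya < 1 -> c < xa ->
  exists h y' x', 0 < h /\ flow V c (a - h) b y' x' /\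
    forall t, a < t -> y' t = y t /\ x' t = x t.
Proof.
intros Hab H Ly Lx Hya Hxa.
destruct (flow_local_existence ya xa Hxa Hya) as [h [y1 [x1 [Hh [Ey [Ex H1]]]]]].
(* At t = a the value is taken from the new piece, which starts at the limit of the old one; this
   makes the glued functions continuous there. *)
pose (glue := fun (u v : R -> R) t => if Rle_dec t a then u (t - a) else v t).
assert (gl : forall u v t, t <= a -> glue u v t = u (t - a)).
{ intros u v t Ht. unfold glue. destruct Rle_dec; [easy|lra]. }
assert (gr : forall u v t, a < t -> glue u v t = v t).
{ intros u v t Ht. unfold glue. destruct Rle_dec; [lra|easy]. }
assert (Hleft : forall u v t d, t < a -> is_derive u (t - a) d -> is_derive (glue u v) t d).
{ intros u v t d Ht Hd.
  apply is_derive_ext_loc with (fun s => u (s - a)).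
  - apply (locally_interval _ t m_infty a); simpl; auto. intros s _ Hs. rewrite gl; [easy|lra].
  - auto_derive; [now exists d|].
    replace (Derive (fun x => u x) (t + - a)) with d by (symmetry; apply is_derive_unique; exact Hd). ring. }
assert (Hright : forall u v t d, a < t -> is_derive v t d -> is_derive (glue u v) t d).
{ intros u v t d Ht Hd.
  apply is_derive_ext_loc with v; [|exact Hd].
  apply (locally_interval _ t a p_infty); simpl; auto. intros s Hs _. now rewrite gr. }
assert (Hcont : forall u v l, u 0 = l -> continuous u 0 -> filterlim v (at_right a) (locally l) ->
  continuous (glue u v) a).
{ intros u v l El Cu Lv. apply continuous_eps. intros e He.
  destruct (proj1 (continuous_eps _ _) Cu e He) as [d1 [Hd1 K1]].
  destruct (proj1 (filterlim_locally _ l) Lv (mkposreal e He)) as [d2 K2].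
  exists (Rmin d1 d2); split; [apply Rmin_pos; [easy|apply cond_pos]|].
  intros t Ht. rewrite (gl u v a), Rminus_diag, El by lra.
  destruct (Rle_dec t a) as [Hta|Hta].
  - rewrite gl by exact Hta. rewrite <- El. apply K1. rewrite Rminus_0_r.
    exact (Rlt_le_trans _ _ _ Ht (Rmin_l _ _)).
  - rewrite gr by lra. apply (K2 t); [|lra]. exact (Rlt_le_trans _ _ _ Ht (Rmin_r _ _)). }
assert (H0 := H1 0 ltac:(simpl; lra) ltac:(simpl; lra)). destruct H0 as [_ [_ [Dy0 Dx0]]].
assert (Cy := Hcont _ _ _ Ey (is_derive_continuous _ _ _ Dy0) Ly).
assert (Cx := Hcont _ _ _ Ex (is_derive_continuous _ _ _ Dx0) Lx).
assert (Va : glue y1 y a = ya /\ glue x1 x a = xa).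
{ rewrite !gl, !Rminus_diag by lra. now split. }
assert (side : forall t : R, a - h < t -> Rbar_lt t b -> t <> a ->
  c < glue x1 x t /\ -1 < glue y1 y t < 1 /\
  is_derive (glue y1 y) t (y_rate V (glue y1 y t) (glue x1 x t)) /\
  is_derive (glue x1 x) t (sqrt (2 / 3) * glue y1 y t)).
{ intros t Ht Hb Hn. destruct (Rlt_dec t a) as [Hta|Hta].
  - rewrite !gl by lra. destruct (H1 (t - a)) as [P1 [P2 [P3 P4]]]; [simpl; lra..|].
    refine (conj P1 (conj P2 (conj _ _))); apply Hleft; auto.
  - rewrite !gr by lra. destruct (H t) as [P1 [P2 [P3 P4]]]; [simpl; lra|exact Hb|].
    refine (conj P1 (conj P2 (conj _ _))); apply Hright; auto; lra. }
assert (Hnear : locally a (fun t => a - h < t /\ Rbar_lt t b)).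
{ apply (locally_interval _ a (a - h) b); simpl; auto; lra. }
destruct Hnear as [r Hr].
exists h, (glue y1 y), (glue x1 x). split; [exact Hh|]. split; [|intros t Ht; now rewrite !gr].
intros t Ht Hb. simpl in Ht.
destruct (Req_dec t a) as [->|Hn]; [|now apply side].
destruct Va as [Va1 Va2].
split; [now rewrite Va2|]. split; [now rewrite Va1|].
assert (punct : forall u, 0 < Rabs (u - a) < r -> a - h < u /\ Rbar_lt u b /\ u <> a).
{ intros u [U1 U2]. destruct (Hr u U2). repeat split; auto. intros ->.
  rewrite Rminus_diag, Rabs_R0 in U1. lra. }
split.
(* Both sides of the seam satisfy the equation and its right-hand side is continuous across it, so
   the equation holds at a as well. *)
- apply (is_derive_extend (glue y1 y) (fun s => y_rate V (glue y1 y s) (glue x1 x s)) a r (cond_pos r)); auto.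
  + intros u Hu. destruct (punct u Hu) as [U1 [U2 U3]]. now apply side.
  + apply continuous_y_rate; auto. now rewrite Va2.
- apply (is_derive_extend (glue x1 x) (fun s => sqrt (2 / 3) * glue y1 y s) a r (cond_pos r)); auto.
  + intros u Hu. destruct (punct u Hu) as [U1 [U2 U3]]. now apply side.
  + apply (continuous_mult (K := R_AbsRing)); [apply continuous_const|exact Cy].
Qed.

End Flow.

(** * The neighbourhood of the kinetic point *)

(** The substitute for integrating to -oo: h - g and h + g are both nondecreasing. *)
Lemma limit_of_dominated_derivative (g dg h dh : R -> R) :
  (forall s, s <= 0 -> is_derive g s (dg s)) ->
  (forall s, s <= 0 -> is_derive h s (dh s)) ->
  (forall s, s <= 0 -> Rabs (dg s) <= dh s) -> (forall s, s <= 0 -> 0 <= h s) ->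
  exists l, forall s, s <= 0 -> Rabs (g s - l) <= h s.
Proof.
intros Dg Dh Hle Hh. apply limit_at_minus_infinity_dist; [exact Hh|].
intros s r Hsr.
assert (H1 : h s - g s <= h r - g r).
{ apply (nondecreasing_of_derive (fun t => h t - g t) (fun t => dh t - dg t)); [lra| |].
  - intros t Ht. apply (is_derive_minus h g); [apply Dh|apply Dg]; lra.
  - intros t Ht. specialize (Hle t ltac:(lra)). generalize (Rle_abs (dg t)); lra. }
assert (H2 : h s + g s <= h r + g r).
{ apply (nondecreasing_of_derive (fun t => h t + g t) (fun t => dh t + dg t)); [lra| |].
  - intros t Ht. apply (is_derive_plus h g); [apply Dh|apply Dg]; lra.
  - intros t Ht. specialize (Hle t ltac:(lra)). generalize (Rle_abs (- dg t)). rewrite Rabs_Ropp; lra. }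
apply Rabs_le; lra.
Qed.

Lemma limit_at_right_of_nondecreasing (g : R -> R) (a m : R) :
  a < 0 -> (forall s r, a < s -> s <= r <= 0 -> g s <= g r) ->
  (forall s, a < s <= 0 -> m <= g s) ->
  exists l, m <= l <= g 0 /\ filterlim g (at_right a) (locally l).
Proof.
intros Ha Hg Hm.
destruct (completeness (fun x => exists s, a < s <= 0 /\ x = - g s)) as [l [Hub Hlub]].
- exists (- m). intros x [s [Hs ->]]. specialize (Hm s Hs); lra.
- exists (- g 0), 0. split; [lra|easy].
- assert (L1 : l <= - m) by (apply Hlub; intros x [s [Hs ->]]; specialize (Hm s Hs); lra).
  assert (L2 : forall s, a < s <= 0 -> - l <= g s).
  { intros s Hs. cut (- g s <= l); [lra|]. apply Hub. now exists s. }
  exists (- l). split; [split; [lra|apply L2; lra]|].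
  apply filterlim_locally. intros e.
  assert (X : exists s, a < s <= 0 /\ g s < - l + e).
  { apply NNPP; intros Hn. assert (l <= l - e); [|generalize (cond_pos e); lra].
    apply Hlub. intros x [s [Hs ->]]. apply Rnot_lt_le; intros Hc. apply Hn.
    exists s. split; [exact Hs|lra]. }
  destruct X as [s [Hs Hgs]].
  assert (Hd : 0 < s - a) by lra.
  exists (mkposreal _ Hd). intros u Hu Hau.
  assert (Hu' : Rabs (u - a) < s - a) by exact Hu. apply Rabs_def2 in Hu'.
  assert (g u <= g s) by (apply Hg; lra).
  specialize (L2 u ltac:(lra)).
  change (Rabs (g u - - l) < e). apply Rabs_def1; generalize (cond_pos e); lra.
Qed.

Section Flow.

Variables (V : R -> R) (N c : R).
Hypothesis V_C2 : Ck 2 V.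
Hypothesis V_pos : forall x, c <= x -> 0 < V x.

(** The exponential form of: ln V is M-Lipschitz beyond X. It comes from V exp(M x) being
    nondecreasing and V exp(-M x) nonincreasing. *)
Lemma potential_comparison (X M : R) :
  c <= X -> (forall x, X < x -> Rabs (Derive V x / V x) <= M) ->
  forall u v, X < u -> X < v -> V u <= V v * exp (M * Rabs (u - v)).
Proof.
intros HX HM.
assert (HD : forall x, X < x -> - M * V x <= Derive V x <= M * V x).
{ intros x Hx. specialize (HM x Hx). assert (P := V_pos x ltac:(lra)).
  replace (Derive V x) with (Derive V x / V x * V x) by (field; lra).
  revert HM. unfold Rabs; destruct Rcase_abs; nra. }
assert (Der : forall m x, is_derive (fun x => V x * exp (m * x)) x ((Derive V x + m * V x) * exp (m * x))).
{ intros m x. auto_derive.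
  - eexists; apply is_derive_potential; exact V_C2.
  - change (Derive (fun x => V x) x) with (Derive V x). ring. }
intros u v Hu Hv.
destruct (Rle_dec u v) as [Huv|Huv].
- rewrite Rabs_left1 by lra.
  assert (H := nondecreasing_of_derive _ _ u v Huv (fun x _ => Der M x)).
  assert (V u * exp (M * u) <= V v * exp (M * v)).
  { apply H. intros x Hx. apply Rmult_le_pos; [|left; apply exp_pos]. specialize (HD x ltac:(lra)); lra. }
  replace (M * - (u - v)) with (M * v + - (M * u)) by ring. rewrite exp_plus, exp_Ropp.
  apply Rmult_le_reg_r with (exp (M * u)); [apply exp_pos|].
  rewrite <- !Rmult_assoc, Rmult_assoc with (r3 := exp (M * u)), Rinv_l; [lra|].
  generalize (exp_pos (M * u)); lra.
- rewrite Rabs_pos_eq by lra.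
  assert (H := nondecreasing_of_derive (fun x => - (V x * exp (- M * x))) (fun x => - ((Derive V x + - M * V x) * exp (- M * x))) v u ltac:(lra)).
  assert (- (V v * exp (- M * v)) <= - (V u * exp (- M * u))).
  { apply H.
    - intros x Hx. apply (is_derive_opp (fun x => V x * exp (- M * x))). apply Der.
    - intros x Hx. rewrite Ropp_mult_distr_l. apply Rmult_le_pos; [|left; apply exp_pos]. specialize (HD x ltac:(lra)); lra. }
  replace (M * (u - v)) with (- M * v + - (- M * u)) by ring. rewrite exp_plus, exp_Ropp.
  apply Rmult_le_reg_r with (exp (- M * u)); [apply exp_pos|].
  rewrite <- !Rmult_assoc, Rmult_assoc with (r3 := exp (- M * u)), Rinv_l; [lra|].
  generalize (exp_pos (- M * u)); lra.
Qed.

(* Linearizing at y = -1, the quantity -(y + V'/(sqrt 6 V)) tends to 1 - N / sqrt 6 > 0. *)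
Lemma rates_near_kinetic_point :
  is_lim (W V N) p_infty 0 -> N ^ 2 < 6 ->
  exists lam X, 0 < lam /\ c <= X /\
    (forall x, X < x -> Rabs (Derive V x / V x) <= Rabs N + 1) /\
    forall y x, X < x -> y < -1 + lam -> lam <= - (y + sqrt (2 / 3) / 2 * (Derive V x / V x)).
Proof.
intros HW HN.
assert (K0 := sqrt_2_3_pos). assert (K2 := sqrt_2_3_sqr). set (k := sqrt (2 / 3)) in *.
(* Since k^2 = 2/3, (k N/2)^2 = N^2/6 < 1: this is where the bound on N enters. *)
assert (Hm : 0 < 1 - k / 2 * N) by nra.
assert (Hk : k <= 1) by nra.
pose (m := 1 - k / 2 * N). fold m in Hm.
assert (He : 0 < Rmin 1 (m / 4)) by (apply Rmin_pos; lra).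
destruct (proj2 (is_lim_spec _ _ _) HW (mkposreal _ He)) as [X0 HX0]. simpl in HX0.
(* At y = -1 and V'/V = N the rate is m. Moving y by lam = m/4 and V'/V by at most m/4 costs at most
   m/4 each, leaving m/2 >= lam. *)
exists (m / 2 / 2), (Rmax c X0). split; [lra|]. split; [apply Rmax_l|].
assert (near : forall x, Rmax c X0 < x -> Rabs (Derive V x / V x - N) < Rmin 1 (m / 4)).
{ intros x Hx. specialize (HX0 x (Rle_lt_trans _ _ _ (Rmax_r _ _) Hx)).
  rewrite Rminus_0_r in HX0. exact HX0. }
split.
- intros x Hx. specialize (near x Hx). assert (H1 := Rlt_le_trans _ _ _ near (Rmin_l _ _)).
  replace (Derive V x / V x) with (N + (Derive V x / V x - N)) by ring.
  eapply Rle_trans; [apply Rabs_triang|]. lra.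
- intros y x Hx Hy. specialize (near x Hx). assert (H1 := Rlt_le_trans _ _ _ near (Rmin_r _ _)).
  apply Rabs_def2 in H1. unfold m in *. set (g := Derive V x / V x) in *.
  assert (k / 2 * (g - N) <= (1 - k / 2 * N) / 4) by nra. lra.
Qed.

Section Box.

Variables (a b : Rbar) (y x : R -> R) (lam del X : R).
Hypothesis a_neg : Rbar_lt a 0.
Hypothesis b_pos : Rbar_lt 0 b.
Hypothesis Hflow : flow V c a b y x.
Hypothesis lam_pos : 0 < lam.
Hypothesis del_le : del <= 1 / 2.
Hypothesis rate : forall y x, X < x -> y < -1 + del ->
  lam <= - (y + sqrt (2 / 3) / 2 * (Derive V x / V x)).
Hypothesis start : y 0 < -1 + del /\ X < x 0.

Lemma flow_at (t : R) : Rbar_lt a t -> t <= 0 ->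
  c < x t /\ -1 < y t < 1 /\
  is_derive y t (y_rate V (y t) (x t)) /\ is_derive x t (sqrt (2 / 3) * y t).
Proof.
intros Ha Ht. apply Hflow; [exact Ha|].
apply (Rbar_le_lt_trans t 0 b); [exact Ht|exact b_pos].
Qed.

Lemma after_start (s t : R) : Rbar_lt a s -> s <= t -> Rbar_lt a t.
Proof. intros Ha Hs. apply (Rbar_lt_le_trans a s t); [exact Ha|exact Hs]. Qed.

(** Inside the corner, going back in time moves y and x away from its two walls. Membership is asked
    only strictly between s and r, so that the lemma applies when s is exactly the time whose
    membership is in question. *)
Lemma box_monotone (s r : R) : Rbar_lt a s -> s <= r <= 0 ->
  (forall t, s < t < r -> y t < -1 + del /\ X < x t) -> y s <= y r /\ x r <= x s.
Proof.
intros Ha Hs HP. split.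
- apply (nondecreasing_of_derive y (fun t => y_rate V (y t) (x t))); [lra| |].
  + intros t Ht. apply flow_at; [apply (after_start s); [exact Ha|lra]|lra].
  + intros t Ht. destruct (HP t Ht) as [Hy Hx].
    destruct (flow_at t) as [_ [Hy1 _]]; [apply (after_start s); [exact Ha|lra]|lra|].
    unfold y_rate. apply Rmult_le_pos; [|nra]. specialize (rate (y t) (x t) Hx Hy); lra.
- cut (- x s <= - x r); [lra|].
  apply (nondecreasing_of_derive (fun t => - x t) (fun t => - (sqrt (2 / 3) * y t))); [lra| |].
  + intros t Ht. apply (is_derive_opp x).
    apply flow_at; [apply (after_start s); [exact Ha|lra]|lra].
  + intros t Ht. destruct (HP t Ht) as [Hy _]. generalize sqrt_2_3_pos. nra.
Qed.

Lemma box_invariant (t : R) : Rbar_lt a t -> t <= 0 -> y t < -1 + del /\ X < x t.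
Proof.
intros Ha Ht.
apply (backward_induction (fun t => y t < -1 + del /\ X < x t) t Ht start).
- intros s Hs [Hy Hx].
  destruct (flow_at s) as [_ [_ [Dy Dx]]]; [apply (after_start t); [exact Ha|lra]|lra|].
  apply filter_and.
  + apply (is_derive_continuous _ _ _ Dy (fun v => v < -1 + del)).
    apply (open_lt (-1 + del)); exact Hy.
  + apply (is_derive_continuous _ _ _ Dx (fun v => X < v)).
    apply (open_gt X); exact Hx.
- intros s Hs HP.
  destruct (box_monotone s 0) as [M1 M2]; [apply (after_start t); [exact Ha|lra]|lra| |].
  + intros r Hr. apply HP; lra.
  + destruct start. lra.
Qed.

Lemma box_nondecreasing (s r : R) : Rbar_lt a s -> s <= r <= 0 -> y s <= y r /\ x r <= x s.
Proof.
intros Ha Hs. apply box_monotone; auto.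
intros t Ht. apply box_invariant; [apply (after_start s); [exact Ha|lra]|lra].
Qed.

(** In finite time 1 + y loses at most an exponential factor and x moves at speed at most k, so the
    monotone limits stay inside the region and the solution can be continued. *)
Lemma box_finite_limits (M a0 : R) : a = Finite a0 ->
  (forall x, X < x -> Rabs (Derive V x / V x) <= M) ->
  exists ya xa, -1 < ya < 1 /\ x 0 <= xa /\
    filterlim y (at_right a0) (locally ya) /\ filterlim x (at_right a0) (locally xa).
Proof.
intros Ea HM.
assert (a0_neg : a0 < 0) by (generalize a_neg; now rewrite Ea).
assert (in_a : forall s : R, a0 < s -> Rbar_lt a s) by (now rewrite Ea).
assert (K0 := sqrt_2_3_pos). assert (K2 := sqrt_2_3_sqr).
assert (Hk : sqrt (2 / 3) <= 1) by nra.
assert (M0 : 0 <= M) by (eapply Rle_trans; [apply Rabs_pos|apply (HM (x 0)), start]).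
pose (C := 2 * (1 + M)).
destruct (flow_at 0) as [_ [Hy0 _]]; [exact a_neg|lra|].
(* As |y + (k/2) V'/V| <= 1 + M and 1 - y <= 2, one has (1 + y)' <= C (1 + y) with C = 2 (1 + M). *)
assert (low : forall s, a0 < s <= 0 -> -1 + (1 + y 0) * exp (C * a0) <= y s).
{ intros s Hs.
  assert (H := exponential_decay (fun t => - (1 + y t)) (fun t => - y_rate V (y t) (x t)) C s ltac:(lra)).
  assert (- (1 + y s) <= - (1 + y 0) * exp (C * s)).
  { apply H.
    - intros t Ht. destruct (flow_at t) as [_ [_ [Dy _]]]; [apply in_a; lra|lra|].
      auto_derive; [now exists (y_rate V (y t) (x t))|].
      replace (Derive (fun x => y x) t) with (y_rate V (y t) (x t)) by (symmetry; apply is_derive_unique, Dy). ring.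
    - intros t Ht. destruct (flow_at t) as [_ [Yt _]]; [apply in_a; lra|lra|].
      destruct (box_invariant t) as [_ Xt]; [apply in_a; lra|lra|].
      specialize (HM (x t) Xt). unfold y_rate, C. set (g := Derive V (x t) / V (x t)) in *.
      assert (G : - M <= g <= M) by (revert HM; unfold Rabs; destruct Rcase_abs; lra).
      assert (- (y t + sqrt (2 / 3) / 2 * g) <= 1 + M) by nra.
      assert (- (y t + sqrt (2 / 3) / 2 * g) * (1 - y t) <= 2 * (1 + M)) by nra.
      replace (1 - y t ^ 2) with ((1 - y t) * (1 + y t)) by ring. nra. }
  assert (exp (C * a0) <= exp (C * s)).
  { destruct (Rle_lt_or_eq_dec (C * a0) (C * s)) as [E|E]; [unfold C; nra| |].
    - left; now apply exp_increasing.
    - rewrite E; lra. }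
  nra. }
assert (0 < (1 + y 0) * exp (C * a0)) by (apply Rmult_lt_0_compat; [lra|apply exp_pos]).
destruct (limit_at_right_of_nondecreasing y a0 (-1 + (1 + y 0) * exp (C * a0)) a0_neg) as [ya [Hya Ly]].
- intros s r Hs Hr. apply box_nondecreasing; auto.
- exact low.
(* x is nonincreasing, hence the sign; its upper bound comes from x' >= -k. *)
- destruct (limit_at_right_of_nondecreasing (fun t => - x t) a0 (- x 0 + sqrt (2 / 3) * a0) a0_neg) as [xa [Hxa Lx]].
  + intros s r Hs Hr. destruct (box_nondecreasing s r); auto; lra.
  + intros s Hs.
    assert (x s + sqrt (2 / 3) * s <= x 0 + sqrt (2 / 3) * 0); [|nra].
    apply (nondecreasing_of_derive (fun t => x t + sqrt (2 / 3) * t) (fun t => sqrt (2 / 3) * y t + sqrt (2 / 3))); [lra| |].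
    * intros t Ht. destruct (flow_at t) as [_ [_ [_ Dx]]]; [apply in_a; lra|lra|].
      auto_derive; [now exists (sqrt (2 / 3) * y t)|].
      replace (Derive (fun u => x u) t) with (sqrt (2 / 3) * y t) by (symmetry; apply is_derive_unique, Dx). ring.
    * intros t Ht. destruct (flow_at t) as [_ [Yt _]]; [apply in_a; lra|lra|]. nra.
  + exists ya, (- xa). split; [lra|]. split; [lra|]. split; [exact Ly|].
    apply filterlim_ext with (fun t => - - x t); [intros; ring|].
    apply (filterlim_comp _ _ _ (fun t => - x t) Ropp _ (locally xa)); [exact Lx|].
    apply (filterlim_opp (V := R_NormedModule)).
Qed.

End Box.

End Flow.

(** * Asymptotics in proper time *)

Section Past.

Variables (V : R -> R) (c : R) (b : Rbar) (y x : R -> R) (lam X M : R).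
Hypothesis V_C2 : Ck 2 V.
Hypothesis V_pos : forall x, c <= x -> 0 < V x.
Hypothesis b_pos : Rbar_lt 0 b.
Hypothesis Hflow : flow V c m_infty b y x.
Hypothesis lam_pos : 0 < lam.
Hypothesis c_le_X : c <= X.
Hypothesis rate : forall y x, X < x -> y < -1 + Rmin (1 / 2) (lam / 4) ->
  lam <= - (y + sqrt (2 / 3) / 2 * (Derive V x / V x)).
Hypothesis log_bound : forall x, X < x -> Rabs (Derive V x / V x) <= M.
Hypothesis box : forall t, t <= 0 -> y t < -1 + Rmin (1 / 2) (lam / 4) /\ X < x t.

Let k := sqrt (2 / 3).
Let w (t : R) : R := 1 - y t ^ 2.
Let q (t : R) : R := sqrt (w t / (3 * V (x t))).

Lemma past_flow (t : R) : Rbar_lt t b ->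
  c < x t /\ -1 < y t < 1 /\ is_derive y t (y_rate V (y t) (x t)) /\ is_derive x t (k * y t).
Proof. intros Ht. now apply Hflow. Qed.

Lemma past_lt (t : R) : t <= 0 -> Rbar_lt t b.
Proof. intros Ht. apply (Rbar_le_lt_trans t 0 b); [exact Ht|exact b_pos]. Qed.

Lemma past_k : 0 < k /\ k <= 1 /\ k * k = 2 / 3.
Proof. unfold k. generalize sqrt_2_3_pos sqrt_2_3_sqr. intros. repeat split; nra. Qed.

Lemma w_pos (t : R) : Rbar_lt t b -> 0 < w t.
Proof. intros Ht. destruct (past_flow t Ht) as [_ [Hy _]]. unfold w. nra. Qed.

Lemma Vx_pos (t : R) : Rbar_lt t b -> 0 < V (x t).
Proof. intros Ht. destruct (past_flow t Ht) as [Hx _]. apply V_pos; lra. Qed.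

Lemma q_pos (t : R) : Rbar_lt t b -> 0 < q t.
Proof.
intros Ht. apply sqrt_lt_R0, Rdiv_lt_0_compat; [now apply w_pos|].
generalize (Vx_pos t Ht); lra.
Qed.

(* The Friedmann constraint, with q = 1/K. *)
Lemma w_eq (t : R) : Rbar_lt t b -> w t = 3 * V (x t) * (q t * q t).
Proof.
intros Ht. unfold q. rewrite sqrt_sqrt.
- field. generalize (Vx_pos t Ht); lra.
- left. apply Rdiv_lt_0_compat; [now apply w_pos|]. generalize (Vx_pos t Ht); lra.
Qed.

(** The derivative of w along the flow. In the corner y and the bracket are both negative, so the
    coefficient of w is positive. *)
Let dw (t : R) : R := 2 * y t * (y t + k / 2 * (Derive V (x t) / V (x t))) * w t.

Lemma is_derive_w (t : R) : Rbar_lt t b -> is_derive w t (dw t).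
Proof.
intros Ht. destruct (past_flow t Ht) as [_ [_ [Dy _]]].
unfold w. auto_derive; [now exists (y_rate V (y t) (x t))|].
replace (Derive (fun u => y u) t) with (y_rate V (y t) (x t)) by (symmetry; apply is_derive_unique, Dy).
unfold y_rate, dw, w. fold k. ring.
Qed.

Lemma is_derive_q (t : R) : Rbar_lt t b -> is_derive q t (y t ^ 2 * q t).
Proof.
intros Ht. destruct (past_flow t Ht) as [_ [_ [_ Dx]]].
assert (Dw := is_derive_w t Ht).
assert (DV := is_derive_comp V x t _ _ (is_derive_potential V V_C2 (x t)) Dx).
assert (P := Vx_pos t Ht). assert (Q := q_pos t Ht). assert (Hw := w_pos t Ht).
assert (DD : is_derive (fun s => w s / (3 * V (x s))) t (2 * y t ^ 2 * (w t / (3 * V (x t))))).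
{ evar_last.
  - apply is_derive_div; [exact Dw| |lra].
    apply (is_derive_scal (fun s => V (x s)) t 3). exact DV.
  - change (scal (k * y t) (Derive V (x t))) with (k * y t * Derive V (x t)).
    unfold dw. field. lra. }
evar_last.
- apply (is_derive_comp sqrt (fun s => w s / (3 * V (x s))) t).
  + apply is_derive_Reals, derivable_pt_lim_sqrt. apply Rdiv_lt_0_compat; lra.
  + exact DD.
- change (2 * y t ^ 2 * (w t / (3 * V (x t))) * / (2 * q t) = y t ^ 2 * q t).
  rewrite (w_eq t Ht). field. lra.
Qed.

Lemma w_rate (t : R) : t <= 0 -> lam * w t <= dw t.
Proof.
intros Ht. destruct (box t Ht) as [Hy Hx]. assert (H := rate _ _ Hx Hy).
assert (Hw := w_pos t (past_lt t Ht)).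
assert (y t < - (1 / 2)) by (generalize (Rmin_l (1 / 2) (lam / 4)); lra).
unfold dw. fold k in H. apply Rmult_le_compat_r; [lra|]. nra.
Qed.

(** Write w = (1 - y)(1 + y): in the corner 1 <= 1 - y <= 2 and 1 + y < lam/4. *)
Lemma w_small (t : R) : t <= 0 -> w t <= lam / 2 /\ 1 + y t <= w t /\ w t <= 1.
Proof.
intros Ht. destruct (box t Ht) as [Hy _]. destruct (past_flow t (past_lt t Ht)) as [_ [Hy1 _]].
assert (Y1 := Rmin_l (1 / 2) (lam / 4)). assert (Y2 := Rmin_r (1 / 2) (lam / 4)).
unfold w. repeat split; nra.
Qed.

(** The rate 1/4 is the lower bound of y^2 for y < -1/2. *)
Lemma q_decay (t : R) : t <= 0 -> q t <= q 0 * exp (/ 4 * t).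
Proof.
intros Ht. apply (exponential_decay q (fun s => y s ^ 2 * q s)); [exact Ht| |].
- intros s Hs. apply is_derive_q, past_lt; lra.
- intros s Hs. destruct (box s) as [Hy _]; [lra|].
  assert (Q := q_pos s (past_lt s ltac:(lra))).
  apply Rmult_le_compat_r; [lra|]. generalize (Rmin_l (1 / 2) (lam / 4)); nra.
Qed.

Lemma w_decay (t : R) : t <= 0 -> w t <= w 0 * exp (lam * t).
Proof.
intros Ht. apply (exponential_decay w dw); [exact Ht| |].
- intros s Hs. apply is_derive_w, past_lt; lra.
- intros s Hs. apply w_rate; lra.
Qed.

Lemma exists_primitive_q : exists T : R -> R, forall t : R, Rbar_lt t b -> is_derive T t (q t).
Proof.
exists (RInt q 0). intros t Ht.
assert (C : forall s : R, Rbar_lt s b -> continuous q s).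
{ intros s Hs. eapply is_derive_continuous, is_derive_q, Hs. }
apply is_derive_RInt with 0; [|now apply C].
apply (locally_interval _ t m_infty b); [exact I|exact Ht|].
intros s _ Hs. apply (RInt_correct (V := R_CompleteNormedModule)), (ex_RInt_continuous (V := R_CompleteNormedModule)).
intros z Hz. apply C. apply (Rbar_le_lt_trans z (Rmax 0 s) b); [apply Hz|].
unfold Rmax; destruct Rle_dec; auto.
Qed.

(* The proper time [T], normalized to vanish at -oo, differs from q = 1/K by at most w q / lam
   because T' - q' = w q while (w q)' >= lam w q. *)
Lemma exists_proper_time : exists T : R -> R,
  (forall t : R, Rbar_lt t b -> is_derive T t (q t)) /\
  forall t, t <= 0 -> Rabs (T t - q t) <= w t * q t / lam.
Proof.
destruct exists_primitive_q as [T DT].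
destruct (limit_of_dominated_derivative (fun t => T t - q t) (fun t => q t - y t ^ 2 * q t)
  (fun t => / lam * (w t * q t)) (fun t => / lam * (dw t * q t + w t * (y t ^ 2 * q t)))) as [l Hl].
- intros s Hs. apply (is_derive_minus T q); [apply DT|apply is_derive_q]; now apply past_lt.
- intros s Hs. apply (is_derive_scal (fun t => w t * q t)).
  apply (is_derive_mult w q); [apply is_derive_w| apply is_derive_q|]; try now apply past_lt.
  intros; apply Rmult_comm.
- intros s Hs. replace (q s - y s ^ 2 * q s) with (w s * q s) by (unfold w; ring).
  assert (Hw := w_pos s (past_lt s Hs)). assert (Q := q_pos s (past_lt s Hs)).
  assert (H := w_rate s Hs).
  rewrite Rabs_pos_eq by nra.
  replace (w s * q s) with (/ lam * (lam * w s * q s)) at 1 by (field; lra).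
  apply Rmult_le_compat_l; [left; now apply Rinv_0_lt_compat|].
  assert (0 <= w s * (y s ^ 2 * q s)) by (apply Rmult_le_pos; [lra|]; apply Rmult_le_pos; [nra|lra]).
  assert (lam * w s * q s <= dw s * q s) by (apply Rmult_le_compat_r; lra). lra.
- intros s Hs. assert (Hw := w_pos s (past_lt s Hs)). assert (Q := q_pos s (past_lt s Hs)).
  apply Rmult_le_pos; [left; now apply Rinv_0_lt_compat|nra].
- exists (fun t => T t - l). split.
  + intros t Ht. replace (q t) with (q t - 0) by ring.
    apply (is_derive_minus T (fun _ => l)); [now apply DT|apply (is_derive_const (V := R_NormedModule))].
  + intros t Ht. replace (T t - l - q t) with (T t - q t - l) by ring.
    unfold Rdiv. rewrite Rmult_comm. now apply Hl.
Qed.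

(** * Proper time as the independent variable *)

Section ProperTime.

Variable T : R -> R.
Hypothesis DT : forall t : R, Rbar_lt t b -> is_derive T t (q t).
Hypothesis T_near : forall t, t <= 0 -> Rabs (T t - q t) <= w t * q t / lam.

Lemma T_bounds (t : R) : t <= 0 -> q t / 2 <= T t <= 2 * q t.
Proof.
intros Ht. assert (Q := q_pos t (past_lt t Ht)). destruct (w_small t Ht) as [W1 _].
assert (H : w t * q t / lam <= q t / 2).
{ replace (q t / 2) with (lam / 2 * q t / lam) by (field; lra).
  apply Rmult_le_compat_r; [left; now apply Rinv_0_lt_compat|].
  apply Rmult_le_compat_r; lra. }
specialize (T_near t Ht). revert T_near. unfold Rabs; destruct Rcase_abs; lra.
Qed.

Lemma T_increasing (s t : R) : s < t -> t <= 0 -> T s < T t.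
Proof.
intros Hst Ht. apply (increasing_of_derive T q); [exact Hst| |].
- intros u Hu. apply DT, past_lt; lra.
- intros u Hu. apply q_pos, past_lt; lra.
Qed.

Lemma exp_small (e : R) : 0 < e -> exists s, s < 0 /\ exp (/ 4 * s) < e.
Proof.
intros He. exists (Rmin (-1) (4 * (ln e - 1))). split.
- generalize (Rmin_l (-1) (4 * (ln e - 1))); lra.
- rewrite <- (exp_ln e He) at 2. apply exp_increasing. generalize (Rmin_r (-1) (4 * (ln e - 1))); lra.
Qed.

Lemma T_onto (t : R) : 0 < t < T 0 -> exists s, s < 0 /\ T s = t.
Proof.
intros Ht. assert (Q0 := q_pos 0 (past_lt 0 (Rle_refl 0))).
(* Chosen so that T s <= 2 q s <= 2 q(0) exp(s/4) < t; the intermediate value theorem does the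
   rest. *)
destruct (exp_small (t / (2 * q 0))) as [s [Hs He]]; [apply Rdiv_lt_0_compat; lra|].
assert (Tlow : T s < t).
{ generalize (T_bounds s ltac:(lra)) (q_decay s ltac:(lra)); intros.
  apply (Rmult_lt_compat_l (2 * q 0)) in He; [|lra].
  replace (2 * q 0 * (t / (2 * q 0))) with t in He by (field; lra). lra. }
destruct (IVT_interv (fun u => T u - t) s 0) as [z [Hz Ez]].
- intros u Hu. apply continuity_pt_minus; [|apply continuity_pt_const; now intros ? ?].
  apply continuity_pt_filterlim. eapply is_derive_continuous, DT, past_lt; lra.
- exact Hs.
- lra.
- lra.
- exists z. split; [|lra]. destruct Hz as [_ [Hz| ->]]; lra.
Qed.

Lemma exists_inverse_time : exists sigma : R -> R, forall t, 0 < t < T 0 ->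
  sigma t < 0 /\ T (sigma t) = t.
Proof.
assert (H : forall t, exists s, 0 < t < T 0 -> s < 0 /\ T s = t).
{ intros t. destruct (excluded_middle_informative (0 < t < T 0)) as [Ht|Hn].
  - destruct (T_onto t Ht) as [s Hs]. now exists s.
  (* An arbitrary value outside the interval of proper time. *)
  - exists 0. tauto. }
exists (fun t => proj1_sig (constructive_indefinite_description _ (H t))).
intros t. now destruct constructive_indefinite_description.
Qed.

Section InverseTime.

Variable sigma : R -> R.
Hypothesis sigma_inv : forall t, 0 < t < T 0 -> sigma t < 0 /\ T (sigma t) = t.

Lemma is_derive_sigma (t : R) : 0 < t < T 0 -> is_derive sigma t (/ q (sigma t)).
Proof.
intros Ht. destruct (sigma_inv t Ht) as [Hs Es].
assert (Q := q_pos _ (past_lt (sigma t) ltac:(lra))).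
(* The lifting lemma is stated for decreasing functions, so -T is inverted along the path -t. *)
replace (/ q (sigma t)) with (- (1) / - q (sigma t)) by (field; lra).
apply (is_derive_lift (fun s => - T s) sigma (fun s => - s) (fun s => s < 0)).
- apply (open_lt 0); exact Hs.
- intros u v Hu Hv Huv. apply Ropp_lt_contravar, T_increasing; lra.
- apply (locally_interval _ t 0 (T 0)); simpl; try apply Ht.
  intros s H1 H2. destruct (sigma_inv s (conj H1 H2)). split; [easy|lra].
- apply (is_derive_opp T), DT, past_lt; lra.
- lra.
- auto_derive; [easy|ring].
Qed.

Lemma sigma_lim : filterlim sigma (at_right 0) (Rbar_locally m_infty).
Proof.
intros P [m Hm].
pose (s := Rmin m (-1)).
assert (Hs : s < 0) by (unfold s; generalize (Rmin_r m (-1)); lra).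
assert (Hp : 0 < T s).
{ generalize (T_bounds s ltac:(lra)) (q_pos s (past_lt s ltac:(lra))); lra. }
exists (mkposreal _ Hp). intros t Ht H0. apply Hm.
assert (Ht' : Rabs (t - 0) < T s) by exact Ht. rewrite Rminus_0_r in Ht'. apply Rabs_def2 in Ht'.
assert (T s < T 0) by (apply T_increasing; lra).
destruct (sigma_inv t ltac:(lra)) as [Hn Et].
apply Rlt_le_trans with s; [|apply Rmin_l].
apply Rnot_le_lt; intros [Hc|Hc].
- generalize (T_increasing s (sigma t) Hc ltac:(lra)); lra.
- rewrite <- Hc in Et. lra.
Qed.

Lemma past_cosmology :
  is_cosmology V (T 0) (fun t => x (sigma t))
    (fun t => k * (y (sigma t) / q (sigma t))) (fun t => / q (sigma t)).
Proof.
intros t Ht. destruct (sigma_inv t Ht) as [Hs Es].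
assert (Dsig := is_derive_sigma t Ht).
set (s := sigma t) in *.
assert (Hb := past_lt s ltac:(lra)).
destruct (past_flow s Hb) as [_ [_ [Dy Dx]]].
assert (Q := q_pos s Hb). assert (Dq := is_derive_q s Hb). assert (P := Vx_pos s Hb).
assert (E := w_eq s Hb). destruct past_k as [K0 [_ K2]].
assert (DJ : is_derive (fun u => k * (y u / q u)) s
   (k * ((y_rate V (y s) (x s) * q s - y s * (y s ^ 2 * q s)) / q s ^ 2))).
{ apply (is_derive_scal (fun u => y u / q u)). apply is_derive_div; [exact Dy|exact Dq|lra]. }
assert (DK : is_derive (fun u => / q u) s (- (y s ^ 2 * q s) / q s ^ 2)).
{ apply is_derive_inv; [exact Dq|lra]. }
assert (E1 : / q s = w s / (3 * V (x s) * (q s * q s * q s))) by (rewrite E; field; lra).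
split; [|split; [|split; [|split]]].
- evar_last; [exact (is_derive_comp x sigma t _ _ Dx Dsig)|].
  change (/ q s * (k * y s) = k * (y s / q s)). field. lra.
- evar_last; [exact (is_derive_comp _ sigma t _ _ DJ Dsig)|].
  change (/ q s * (k * ((y_rate V (y s) (x s) * q s - y s * (y s ^ 2 * q s)) / q s ^ 2)) =
    - / q s * (k * (y s / q s)) - Derive V (x s)).
  assert (Y : y_rate V (y s) (x s) = - y s * w s - k / 2 * (Derive V (x s) / V (x s)) * w s).
  { unfold y_rate, w. fold k. ring. }
  rewrite Y. replace (y s * (y s ^ 2 * q s)) with (y s * q s * (1 - w s)) by (unfold w; ring).
  (* The constraint w/q^2 = 3 V and k^2 = 2/3 express V' through V'/V, w and q, which leaves an
     identity of rational functions. *)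
  replace (Derive V (x s)) with (k * k / 2 * (Derive V (x s) / V (x s)) * (w s / (q s * q s))) at 2.
  + field. lra.
  + rewrite E, K2. field. lra.
- evar_last; [exact (is_derive_comp _ sigma t _ _ DK Dsig)|].
  change (/ q s * (- (y s ^ 2 * q s) / q s ^ 2) = - (3 / 2) * (k * (y s / q s)) ^ 2).
  replace ((k * (y s / q s)) ^ 2) with (k * k * (y s / q s) ^ 2) by ring. rewrite K2. field. lra.
- cbv beta. fold s. replace ((k * (y s / q s)) ^ 2) with (k * k * (y s / q s) ^ 2) by ring.
  rewrite K2. replace ((/ q s) ^ 2) with ((w s + y s ^ 2) / (q s * q s)) by (unfold w; field; lra).
  rewrite E. field. lra.
- now apply Rinv_0_lt_compat.
Qed.

(** In the derivative k ((1 + y) - (T - q)/T) the first term is at most w and the second at most 2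
    w/lam, because T >= q/2. The remaining factor 1/lam comes from w <= w'/lam. *)
Lemma exists_phase : exists chi, forall s, s <= 0 ->
  Rabs (x s + k * ln (T s) - chi) <= (1 + 2 / lam) / lam * w s.
Proof.
destruct past_k as [K0 [K1 K2]].
assert (L0 : 0 < / lam) by now apply Rinv_0_lt_compat.
apply (limit_of_dominated_derivative (fun s => x s + k * ln (T s)) (fun s => k * y s + k * (q s / T s))
  (fun s => (1 + 2 / lam) / lam * w s) (fun s => (1 + 2 / lam) / lam * dw s)).
- intros s Hs. assert (Hb := past_lt s Hs). destruct (past_flow s Hb) as [_ [_ [_ Dx]]].
  assert (Q := q_pos s Hb). assert (B := T_bounds s Hs).
  apply (is_derive_plus x (fun s => k * ln (T s))); [exact Dx|].
  apply (is_derive_scal (fun s => ln (T s))).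
  evar_last; [apply (is_derive_comp ln T s); [apply is_derive_ln; lra|now apply DT]|].
  reflexivity.
- intros s Hs. apply (is_derive_scal w). now apply is_derive_w, past_lt.
- intros s Hs. assert (Hb := past_lt s Hs). destruct (past_flow s Hb) as [_ [Y _]].
  assert (Q := q_pos s Hb). assert (B := T_bounds s Hs). assert (Hw := w_pos s Hb).
  destruct (w_small s Hs) as [_ [W1 _]]. assert (H := w_rate s Hs).
  replace (k * y s + k * (q s / T s)) with (k * ((1 + y s) - (T s - q s) / T s)) by (field; lra).
  rewrite Rabs_mult, (Rabs_pos_eq k) by lra.
  assert (E : Rabs ((T s - q s) / T s) <= 2 / lam * w s).
  { unfold Rdiv at 1. rewrite Rabs_mult, Rabs_inv, (Rabs_pos_eq (T s)) by lra.
    apply Rmult_le_reg_r with (T s); [lra|]. rewrite Rmult_assoc, Rinv_l, Rmult_1_r by lra.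
    eapply Rle_trans; [now apply T_near|].
    replace (w s * q s / lam) with (2 / lam * w s * (q s / 2)) by (field; lra).
    apply Rmult_le_compat_l; [|lra]. unfold Rdiv. nra. }
  assert (F : Rabs (1 + y s - (T s - q s) / T s) <= (1 + 2 / lam) * w s).
  { unfold Rminus at 1. eapply Rle_trans; [apply Rabs_triang|]. rewrite Rabs_Ropp, (Rabs_pos_eq (1 + y s)) by lra. lra. }
  apply Rle_trans with ((1 + 2 / lam) * w s).
  { generalize (Rabs_pos (1 + y s - (T s - q s) / T s)). nra. }
  replace ((1 + 2 / lam) * w s) with ((1 + 2 / lam) / lam * (lam * w s)) by (field; lra).
  apply Rmult_le_compat_l; [|exact H]. unfold Rdiv. nra.
- intros s Hs. assert (Hw := w_pos s (past_lt s Hs)). unfold Rdiv.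
  apply Rmult_le_pos; [|lra]. nra.
Qed.

Lemma eps_V_dominates (chi : R) :
  (forall s, s <= 0 -> Rabs (x s + k * ln (T s) - chi) <= (1 + 2 / lam) / lam * w s) ->
  exists C, 0 < C /\ at_right 0 (fun t => 0 < t < T 0 /\ 0 < eps_V V t /\
    w (sigma t) <= C * (t * eps_V V t)).
Proof.
intros Hchi. destruct past_k as [K0 [K1 K2]].
assert (L0 : 0 < / lam) by now apply Rinv_0_lt_compat.
pose (C1 := (1 + 2 / lam) / lam). assert (HC1 : 0 < C1) by (unfold C1, Rdiv; nra).
assert (M0 : 0 <= M).
{ eapply Rle_trans; [apply Rabs_pos|]. apply (log_bound (x 0)), box; lra. }
pose (E := exp (M * (C1 + Rabs chi))). assert (HE : 0 < E) by apply exp_pos.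
(* From w = 3 V(x) q^2 with q <= 2t, and V(x) <= E V(-k ln t). *)
exists (12 * E). split; [lra|].
assert (T0 : 0 < T 0).
{ generalize (T_bounds 0 ltac:(lra)) (q_pos 0 (past_lt 0 ltac:(lra))); lra. }
(* Below the second bound -k ln t exceeds X, where the comparison of potentials is valid. *)
pose (r := Rmin (T 0) (exp (- (X + 1) / k))).
assert (Hr : 0 < r) by (apply Rmin_pos; [lra|apply exp_pos]).
exists (mkposreal _ Hr). intros t Ht H0.
assert (Ht' : Rabs (t - 0) < r) by exact Ht. rewrite Rminus_0_r in Ht'. apply Rabs_def2 in Ht'.
assert (R1 : r <= T 0) by apply Rmin_l.
assert (R2 : r <= exp (- (X + 1) / k)) by apply Rmin_r.
assert (Hlog : X < - k * ln t).
{ assert (ln t < - (X + 1) / k).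
  { rewrite <- (ln_exp (- (X + 1) / k)). apply ln_increasing; lra. }
  assert (k * ln t < k * (- (X + 1) / k)) by (apply Rmult_lt_compat_l; lra).
  replace (k * (- (X + 1) / k)) with (- (X + 1)) in H1 by (field; lra). lra. }
destruct (sigma_inv t ltac:(lra)) as [Hs Es]. set (s := sigma t) in *.
assert (Hb := past_lt s ltac:(lra)).
assert (VP : 0 < V (- k * ln t)) by (apply V_pos; lra).
split; [lra|]. split; [unfold eps_V; fold k; apply Rmult_lt_0_compat; lra|].
unfold eps_V. fold k.
destruct (box s) as [_ Hx]; [lra|].
assert (HV : V (x s) <= V (- k * ln t) * E).
{ eapply Rle_trans; [apply (potential_comparison V c V_C2 V_pos X M c_le_X log_bound (x s) (- k * ln t) Hx Hlog)|].
  apply Rmult_le_compat_l; [lra|]. unfold E.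
  assert (Rabs (x s - - k * ln t) <= C1 + Rabs chi).
  { specialize (Hchi s ltac:(lra)). rewrite Es in Hchi. fold C1 in Hchi.
    destruct (w_small s) as [_ [_ W]]; [lra|].
    replace (x s - - k * ln t) with ((x s + k * ln t - chi) + chi) by ring.
    eapply Rle_trans; [apply Rabs_triang|]. apply Rplus_le_compat_r. nra. }
  destruct (Rle_lt_or_eq_dec (M * Rabs (x s - - k * ln t)) (M * (C1 + Rabs chi))) as [L|L].
  - apply Rmult_le_compat_l; lra.
  - left. now apply exp_increasing.
  - rewrite L. lra. }
rewrite (w_eq s Hb). generalize (T_bounds s ltac:(lra)) (q_pos s Hb) (Vx_pos s Hb). rewrite Es. intros B Q P.
assert (q s * q s <= 4 * (t * t)) by nra.
replace (12 * E * (t * (t * V (- k * ln t)))) with (3 * (V (- k * ln t) * E) * (4 * (t * t))) by ring.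
apply Rmult_le_compat; nra.
Qed.

Lemma past_asymptotics : exists c0, 0 < c0 /\
  bigO (at_right 0) (fun t => / q (sigma t) - / t) (eps_V V) /\
  bigO (at_right 0) (fun t => x (sigma t) - - k * ln (t / c0)) (fun t => t * eps_V V t) /\
  bigO (at_right 0) (fun t => k * (y (sigma t) / q (sigma t)) - - k * / t) (eps_V V).
Proof.
destruct past_k as [K0 [K1 K2]].
assert (L0 : 0 < / lam) by now apply Rinv_0_lt_compat.
destruct exists_phase as [chi Hchi].
destruct (eps_V_dominates chi Hchi) as [C [HC Hev]].
pose (C1 := (1 + 2 / lam) / lam). assert (HC1 : 0 < C1) by (unfold C1, Rdiv; nra).
assert (HK : forall t, 0 < t < T 0 -> Rabs (/ q (sigma t) - / t) <= w (sigma t) / (lam * t)).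
{ intros t Ht. destruct (sigma_inv t Ht) as [Hs Es]. set (s := sigma t) in *.
  assert (Q := q_pos s (past_lt s ltac:(lra))). assert (Hw := w_pos s (past_lt s ltac:(lra))).
  replace (/ q s - / t) with ((T s - q s) / (q s * t)) by (rewrite Es; field; lra).
  assert (Z : 0 < / (q s * t)) by (apply Rinv_0_lt_compat; nra).
  unfold Rdiv at 1. rewrite Rabs_mult, (Rabs_pos_eq (/ _)) by lra.
  replace (w s / (lam * t)) with (w s * q s / lam * / (q s * t)) by (field; lra).
  apply Rmult_le_compat_r; [lra|]. apply T_near; lra. }
assert (Hwt : forall t e, 0 < t -> w (sigma t) <= C * (t * e) -> w (sigma t) / t <= C * e).
{ intros t e Ht Hw. apply Rmult_le_reg_r with t; [exact Ht|].
  unfold Rdiv. rewrite Rmult_assoc, Rinv_l by lra. lra. }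
(* Solves chi = k ln c, so that x + k ln t - chi is the deviation of phi from -k ln (t/c). *)
exists (exp (chi / k)). split; [apply exp_pos|].
split; [|split].
- exists (C / lam). apply (filter_imp _ _ (F := at_right 0)) with (2 := Hev).
  intros t [Ht [He Hw]]. eapply Rle_trans; [now apply HK|].
  rewrite Rabs_pos_eq by lra. specialize (Hwt t (eps_V V t) ltac:(lra) Hw).
  replace (w (sigma t) / (lam * t)) with (/ lam * (w (sigma t) / t)) by (field; lra).
  unfold Rdiv. rewrite (Rmult_comm C), Rmult_assoc. apply Rmult_le_compat_l; lra.
- exists (C1 * C). apply (filter_imp _ _ (F := at_right 0)) with (2 := Hev).
  intros t [Ht [He Hw]]. destruct (sigma_inv t Ht) as [Hs Es].
  specialize (Hchi (sigma t) ltac:(lra)). rewrite Es in Hchi.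
  rewrite ln_div, ln_exp by (try apply exp_pos; lra).
  replace (x (sigma t) - - k * (ln t - chi / k)) with (x (sigma t) + k * ln t - chi) by (field; lra).
  eapply Rle_trans; [exact Hchi|]. fold C1.
  rewrite Rabs_pos_eq by (apply Rmult_le_pos; lra).
  rewrite Rmult_assoc. apply Rmult_le_compat_l; lra.
- exists (C * (2 + / lam)). apply (filter_imp _ _ (F := at_right 0)) with (2 := Hev).
  intros t [Ht [He Hw]]. specialize (HK t Ht). destruct (sigma_inv t Ht) as [Hs Es].
  specialize (Hwt t (eps_V V t) ltac:(lra) Hw). set (s := sigma t) in *.
  assert (Hb := past_lt s ltac:(lra)). destruct (past_flow s Hb) as [_ [Y _]].
  assert (Q := q_pos s Hb). destruct (w_small s) as [_ [W1 _]]; [lra|].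
  assert (B := T_bounds s ltac:(lra)). rewrite Es in B. assert (Hw0 := w_pos s Hb).
  rewrite (Rabs_pos_eq (eps_V V t)) by lra.
  (* The error of dphi splits into the deviation of y from -1, at most w/q <= 2 w/t, and the error
     of K already estimated in [HK]. *)
  replace (k * (y s / q s) - - k * / t) with (k * ((1 + y s) * / q s - (/ q s - / t))) by (field; lra).
  rewrite Rabs_mult, (Rabs_pos_eq k) by lra.
  assert (QI : / q s <= 2 * / t).
  { apply Rmult_le_reg_r with (q s * t); [nra|]. field_simplify; lra. }
  assert (QP : 0 < / q s) by now apply Rinv_0_lt_compat.
  assert (F1 : Rabs ((1 + y s) * / q s) <= 2 * (w s / t)).
  { rewrite Rabs_pos_eq by nra. replace (2 * (w s / t)) with (w s * (2 * / t)) by (field; lra).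
    apply Rmult_le_compat; lra. }
  replace (w s / (lam * t)) with (/ lam * (w s / t)) in HK by (field; lra).
  assert (F2 : Rabs ((1 + y s) * / q s - (/ q s - / t)) <= (2 + / lam) * (w s / t)).
  { unfold Rminus at 1. eapply Rle_trans; [apply Rabs_triang|]. rewrite Rabs_Ropp. lra. }
  apply Rle_trans with ((2 + / lam) * (w s / t)).
  { generalize (Rabs_pos ((1 + y s) * / q s - (/ q s - / t))). nra. }
  replace (C * (2 + / lam) * eps_V V t) with ((2 + / lam) * (C * eps_V V t)) by ring.
  apply Rmult_le_compat_l; lra.
Qed.

End InverseTime.

End ProperTime.

Lemma exists_past_cosmology :
  exists (t1 : R) (phi dphi K sigma : R -> R),
    0 < t1 /\ is_cosmology V t1 phi dphi K /\
    (forall t, 0 < t < t1 -> sigma t < 0 /\ phi t = x (sigma t) /\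
       sqrt (3 / 2) * dphi t / K t = y (sigma t) /\ is_derive sigma t (K t)) /\
    filterlim sigma (at_right 0) (Rbar_locally m_infty) /\
    exists c0, 0 < c0 /\
      bigO (at_right 0) (fun t => K t - / t) (eps_V V) /\
      bigO (at_right 0) (fun t => phi t - - sqrt (2 / 3) * ln (t / c0)) (fun t => t * eps_V V t) /\
      bigO (at_right 0) (fun t => dphi t - - sqrt (2 / 3) * / t) (eps_V V).
Proof.
destruct exists_proper_time as [T [DT T_near]].
destruct (exists_inverse_time T DT T_near) as [sigma Hsig].
exists (T 0), (fun t => x (sigma t)), (fun t => k * (y (sigma t) / q (sigma t))),
  (fun t => / q (sigma t)), sigma.
split; [|split; [|split; [|split]]].
- generalize (T_bounds T T_near 0 (Rle_refl 0)) (q_pos 0 (past_lt 0 (Rle_refl 0))); lra.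
- now apply past_cosmology.
- intros t Ht. destruct (Hsig t Ht) as [Hs _].
  split; [exact Hs|]. split; [reflexivity|]. split; [|now apply (is_derive_sigma T)].
  assert (E : sqrt (3 / 2) * k = 1).
  { unfold k. rewrite <- sqrt_mult by lra. replace (3 / 2 * (2 / 3)) with 1 by field. apply sqrt_1. }
  rewrite <- Rmult_assoc, E. field. generalize (q_pos (sigma t) (past_lt (sigma t) ltac:(lra))); lra.
- now apply (sigma_lim T).
- now apply (past_asymptotics T).
Qed.

Lemma past_limit_y : filterlim y (Rbar_locally m_infty) (locally (-1)).
Proof.
apply filterlim_locally. intros e.
assert (Hw := w_pos 0 (past_lt 0 (Rle_refl 0))).
assert (He : 0 < e / w 0) by (apply Rdiv_lt_0_compat; [apply cond_pos|exact Hw]).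
exists (Rmin 0 (ln (e / w 0) / lam)). intros t Ht.
assert (T1 := Rlt_le_trans _ _ _ Ht (Rmin_l _ _)).
assert (T2 := Rlt_le_trans _ _ _ Ht (Rmin_r _ _)).
destruct (w_small t ltac:(lra)) as [_ [W _]]. assert (D := w_decay t ltac:(lra)).
destruct (past_flow t (past_lt t ltac:(lra))) as [_ [Y _]].
assert (exp (lam * t) < e / w 0).
{ rewrite <- (exp_ln _ He). apply exp_increasing.
  apply (Rmult_lt_compat_l lam) in T2; [|lra].
  replace (lam * (ln (e / w 0) / lam)) with (ln (e / w 0)) in T2 by (field; lra). exact T2. }
apply (Rmult_lt_compat_l (w 0)) in H; [|lra].
replace (w 0 * (e / w 0)) with (pos e) in H by (field; lra).
change (Rabs (y t - -1) < e). apply Rabs_def1; lra.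
Qed.

Lemma past_limit_x : filterlim x (Rbar_locally m_infty) (Rbar_locally p_infty).
Proof.
intros P [m Hm]. destruct past_k as [K0 _].
(* Since y < -1/2, x grows backwards at speed at least k/2. *)
exists (Rmin 0 (- 2 / k * (Rabs (m - x 0)))). intros t Ht. apply Hm.
assert (T1 := Rlt_le_trans _ _ _ Ht (Rmin_l _ _)).
assert (T2 := Rlt_le_trans _ _ _ Ht (Rmin_r _ _)).
assert (H : - (x t + k / 2 * t) <= - (x 0 + k / 2 * 0)).
{ apply (nondecreasing_of_derive (fun s => - (x s + k / 2 * s)) (fun s => - (k * y s + k / 2))); [lra| |].
  - intros s Hs. destruct (past_flow s (past_lt s ltac:(lra))) as [_ [_ [_ Dx]]].
    auto_derive; [now exists (k * y s)|].
    replace (Derive (fun u => x u) s) with (k * y s) by (symmetry; apply is_derive_unique, Dx). ring.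
  - intros s Hs. destruct (box s) as [Hy _]; [lra|]. generalize (Rmin_l (1 / 2) (lam / 4)). nra. }
apply (Rmult_lt_compat_l (k / 2)) in T2; [|lra].
replace (k / 2 * (-2 / k * Rabs (m - x 0))) with (- Rabs (m - x 0)) in T2 by (field; lra).
generalize (Rle_abs (m - x 0)); lra.
Qed.

End Past.

(** * Return to trajectories in the (y, z)-plane *)

Lemma trajectory_past_infinite (V : R -> R) (N phi0 : R) (f : R -> R) (eps : R)
  (hf : WBI_coordinate 2 V N phi0 f) (heps_phi0 : phi0 <= / eps)
  (V_C2 : Ck 2 V) (V_pos : forall x, / eps <= x -> 0 < V x)
  (lam del X M : R) (lam_pos : 0 < lam) (del_le : del <= 1 / 2) (X_ge : / eps <= X)
  (rate : forall y x, X < x -> y < -1 + del ->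
     lam <= - (y + sqrt (2 / 3) / 2 * (Derive V x / V x)))
  (log_bound : forall x, X < x -> Rabs (Derive V x / V x) <= M)
  (p : R * R) (a b : Rbar) (psi : R -> R * R) :
  is_trajectory V N phi0 f eps p a b psi ->
  fst p < -1 + del -> X < finv phi0 f (snd p) -> a = m_infty.
Proof.
intros [Ha [Hb [Ep [Hsol Hmax]]]] Hp1 Hp2.
assert (Hflow := flow_of_solution V N phi0 f eps hf heps_phi0 a b psi Hsol).
destruct a as [a0| |]; [exfalso|destruct Ha|reflexivity].
destruct (box_finite_limits V (/ eps) (Finite a0) b (fun t => fst (psi t)) (fun t => finv phi0 f (snd (psi t)))
  lam del X Ha Hb Hflow lam_pos del_le rate) with (M := M) (a0 := a0)
  as [ya [xa [Hya [Hxa [Ly Lx]]]]]; auto.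
{ rewrite Ep. now split. }
rewrite Ep in Hxa.
assert (Hab : Rbar_lt a0 b) by now apply (Rbar_lt_trans a0 0 b).
destruct (flow_extend V (/ eps) V_C2 V_pos a0 b _ _ ya xa Hab Hflow Ly Lx Hya ltac:(lra))
  as [h [y' [x' [Hh [Hflow' Hext]]]]].
(* The continuation, carried back by z = f(x), is a solution on a longer interval; inextensibility
   then forces a0 - h = a0. *)
destruct (Hmax (a0 - h) b (fun t => (y' t, f (x' t)))) as [E _].
- simpl; lra.
- apply Rbar_le_refl.
- exact (solution_of_flow V N phi0 f eps hf heps_phi0 _ b y' x' Hflow').
- intros t Hat Hbt. destruct (Hext t Hat) as [-> ->].
  destruct (Hsol t Hat Hbt) as [[Hz _] _].
  destruct (coord_onto_below V N phi0 f hf (/ eps) (snd (psi t)) heps_phi0 Hz) as [_ ->].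
  now destruct (psi t).
- injection E; lra.
Qed.

Theorem theorem4 (V : R -> R) (N : R) (hV : class_WBI 2 V N) (hN : N ^ 2 < 6)
  (phi0 : R) (f : R -> R) (hf : WBI_coordinate 2 V N phi0 f)
  (eps : R) (heps : 0 < eps) (heps_phi0 : phi0 <= / eps)
  (heps_V : forall phi, / eps <= phi -> 0 < V phi) :
  exists U : R * R -> Prop,
    locally ((-1, 0) : R * R) U /\
    forall p : R * R, U p -> Omega f eps p ->
    forall (a b : Rbar) (psi : R -> R * R),
      is_trajectory V N phi0 f eps p a b psi ->
      a = m_infty /\
      filterlim psi (Rbar_locally m_infty) (locally ((-1, 0) : R * R)) /\
      exists (t1 : R) (phi dphi K sigma : R -> R),
        0 < t1 /\
        is_cosmology V t1 phi dphi K /\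
        proper_time_form f eps a b psi t1 phi dphi K sigma /\
        filterlim sigma (at_right 0) (Rbar_locally m_infty) /\
        exists c : R, 0 < c /\
          bigO (at_right 0) (fun t => K t - / t) (eps_V V) /\
          bigO (at_right 0) (fun t => phi t - - sqrt (2 / 3) * ln (t / c))
            (fun t => t * eps_V V t) /\
          bigO (at_right 0) (fun t => dphi t - - sqrt (2 / 3) * / t) (eps_V V).
Proof.
destruct hV as [hW [V_C2 _]].
destruct (rates_near_kinetic_point V N (/ eps) (WBI_lim _ _ hW) hN)
  as [lam [X [lam_pos [X_ge [log_bound rate0]]]]].
set (M := Rabs N + 1) in log_bound.
pose (del := Rmin (1 / 2) (lam / 4)).
assert (del_le : del <= 1 / 2) by apply Rmin_l.
assert (del_le_lam : del <= lam / 4) by apply Rmin_r.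
assert (del_pos : 0 < del) by (apply Rmin_pos; lra).
assert (rate : forall y x, X < x -> y < -1 + del ->
  lam <= - (y + sqrt (2 / 3) / 2 * (Derive V x / V x))).
{ intros y x Hx Hy. apply rate0; [exact Hx|lra]. }
assert (fX : 0 < f X) by (apply (coord_pos V N phi0 f hf); lra).
(* As f decreases, z < f X is the condition phi > X; membership in [Omega] bounds y and z from
   below. *)
exists (fun p => fst p < -1 + del /\ snd p < f X). split.
{ assert (Hr : 0 < Rmin del (f X)) by now apply Rmin_pos.
  exists (mkposreal _ Hr). intros [u v] [H1 H2].
  assert (G1 : Rabs (u - -1) < Rmin del (f X)) by exact H1.
  assert (G2 : Rabs (v - 0) < Rmin del (f X)) by exact H2.
  apply Rabs_def2 in G1, G2.
  generalize (Rmin_l del (f X)) (Rmin_r del (f X)). simpl. lra. }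
intros p [Up1 Up2] [Hz Hy] a b psi Htraj.
assert (Hx0 : X < finv phi0 f (snd p)).
{ apply (coord_onto_below V N phi0 f hf); lra. }
assert (Ea := trajectory_past_infinite V N phi0 f eps hf heps_phi0 V_C2 heps_V lam del X M
  lam_pos del_le X_ge rate log_bound p a b psi Htraj Up1 Hx0).
split; [exact Ea|]. subst a.
destruct Htraj as [Ha [Hb [Ep [Hsol _]]]].
assert (Hflow := flow_of_solution V N phi0 f eps hf heps_phi0 m_infty b psi Hsol).
set (y := fun t => fst (psi t)) in *. set (x := fun t => finv phi0 f (snd (psi t))) in *.
assert (box : forall t, t <= 0 -> y t < -1 + del /\ X < x t).
{ intros t Ht.
  apply (box_invariant V (/ eps) m_infty b y x lam del X Hb Hflow lam_pos del_le rate);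
    [|exact I|exact Ht].
  unfold y, x. rewrite Ep. now split. }
assert (fx : forall t : R, Rbar_lt t b -> f (x t) = snd (psi t)).
{ intros t Ht. destruct (Hsol t I Ht) as [[Hzt _] _].
  now apply (coord_onto_below V N phi0 f hf (/ eps)). }
assert (before : forall t : R, t <= 0 -> Rbar_lt t b) by (intros t Ht; now apply (past_lt b Hb)).
split.
{ apply filterlim_ext_loc with (fun t => (y t, f (x t))).
  - exists 0. intros t Ht. rewrite fx by (apply before; lra). unfold y. now destruct (psi t).
  - assert (Ly : filterlim y (Rbar_locally m_infty) (locally (-1)))
      by exact (past_limit_y V (/ eps) b y x lam X Hb Hflow lam_pos rate box).
    assert (Lf : filterlim (fun t => f (x t)) (Rbar_locally m_infty) (locally 0)).
    { apply (filterlim_comp _ _ _ x f _ (Rbar_locally p_infty)).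
      + exact (past_limit_x V (/ eps) b y x lam X Hb Hflow box).
      + exact (coord_lim _ _ _ _ _ hf). }
    apply filterlim_locally. intros e.
    generalize (filter_and _ _ (proj1 (filterlim_locally _ _) Ly e) (proj1 (filterlim_locally _ _) Lf e)).
    apply filter_imp. intros t Ht. exact Ht. }
destruct (exists_past_cosmology V (/ eps) b y x lam X M V_C2 heps_V Hb Hflow lam_pos X_ge rate log_bound box)
  as [t1 [phi [dphi [K [sigma [Ht1 [Hcosm [Hsig Hrest]]]]]]]].
exists t1, phi, dphi, K, sigma.
split; [exact Ht1|]. split; [exact Hcosm|]. split; [|exact Hrest].
intros t Ht. destruct (Hsig t Ht) as [Hs [Ephi [Ey Dsig]]].
assert (Hsb := before (sigma t) (Rlt_le _ _ Hs)).
split; [exact I|]. split; [exact Hsb|]. rewrite Ephi, Ey, fx by exact Hsb.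
split; [now apply Hflow|]. split; [|exact Dsig].
unfold y. now destruct (psi (sigma t)).
Qed.
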